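(* Let $Z$ be an admissible discrete subset of $S^1$ and let $\mathcal S$ be a cluster in the triangulated category $\mathcal C_{can}(Z)$. Then: (1) The mapping $\psi_{\mathcal S}:|K(\mathcal S)|\to D^2$ is continuous and one-to-one. (2) $\psi_{\mathcal S}$ is a homeomorphism onto an open subset of $D^2$ if and only if $\mathcal S$ is locally finite.
   Context: A subset $Z\subset S^1$ is an admissible discrete subset if: (1) every element of $Z$ has an open neighborhood in $S^1$ containing no other element of $Z$; (2) every point of $S^1$ which is a limit point of $Z$ is a limit of $Z$ from both sides; (3) $Z$ has at least four elements. Then each $z\in Z$ has a successor $z^+\in Z$ and predecessor $z^-\in Z$ (next element of $Z$ counterclockwise, resp. clockwise). $\mathcal C_{can}(Z)$ is the triangulated category associated to the cyclically ordered set $Z$ with its canonical automorphism $z\mapsto z^+$ (the stable category of a Frobenius category of matrix factorizations of $t$ over $k[[t]]$). For the present statement only the following is needed: its indecomposable objects, up to isomorphism, are $E(x,y)\cong E(y,x)$ for $x,y\in Z$ with $y\neq x,x^+,x^-$; to $E(x,y)$ one associates the closed hyperbolic geodesic $\widehat{xy}$ in the closed unit disk $D^2$ (Poincaré model) with endpoints $x,y$; two such objects are compatible ($\operatorname{Ext}^1$ vanishes in both directions) if and only if their geodesics do not cross in the interior of $D^2$. A cluster is a maximal set of pairwise compatible, pairwise nonisomorphic indecomposable objects. A cluster $\mathcal S$ is locally finite if every element of $Z$ occurs only finitely many times as an endpoint of an element of $\mathcal S$. The simplicial complex $K(\mathcal S)$ has vertex set $Z$; $\{x,y\}$ is a 1-simplex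 iff either $E(x,y)\in\mathcal S$ (up to isomorphism) or $y\in\{x^+,x^-\}$; $\{x,y,z\}$ is a 2-simplex iff all three pairs are 1-simplices; there are no higher simplices. $|K(\mathcal S)|$ is its geometric realization (weak topology). The map $\psi_{\mathcal S}:|K(\mathcal S)|\to D^2$ sends each vertex to itself, each 1-simplex $\{z,z^+\}$ homeomorphically to the arc of $S^1$ from $z$ to $z^+$, every other 1-simplex $\{x,y\}$ homeomorphically to the closed geodesic $\widehat{xy}$, and each 2-simplex by a homeomorphism (extending the given boundary map) onto the closed region of $D^2$ enclosed by the image of its boundary. *)

(* Defs.v *)
From HB Require Import structures.
From mathcomp Require Import all_boot all_order all_algebra.
From mathcomp Require Import all_classical all_reals all_analysis.

Set Implicit Arguments.
Unset Strict Implicit.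
Unset Printing Implicit Defensive.

Import Order.TTheory GRing.Theory Num.Theory.
Import numFieldNormedType.Exports.
Local Open Scope classical_set_scope.
Local Open Scope ring_scope.

(** * Plane geometry: [S^1], the closed disk, cyclic order, geodesics *)

Section Plane.
Context {R : realType}.
Implicit Types (x y z p c u : R * R) (J L Z : set (R * R)).

Definition dot x y : R := x.1 * y.1 + x.2 * y.2.

Definition cross x y : R := x.1 * y.2 - x.2 * y.1.

Definition circle : set (R * R) := [set p | dot p p = 1].

Definition disk : set (R * R) := [set p | dot p p <= 1].

(** For three points of the circle: going counterclockwise from [x] one meets
    [y] strictly before [z], i.e. the triangle [xyz] is positively oriented. *)
Definition ccw x y z : Prop := 0 < cross (y - x) (z - x).

(** Closed counterclockwise arc from [x] to [y] (for [x <> y]). *)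
Definition arc x y : set (R * R) :=
  [set p | circle p /\ [\/ p = x, p = y | ccw x p y]].

(** Carriers of the complete geodesics of the Poincare disk: the circle of
    centre [c] orthogonal to [S^1] has squared radius [|c|^2 - 1]; the other
    geodesics lie on the lines through the origin. *)
Definition hyperbolic_line L : Prop :=
  (exists c, 1 < dot c c /\ L = [set p | dot (p - c) (p - c) = dot c c - 1]) \/
  (exists u, u <> 0 /\ L = [set p | dot u p = 0]).

(** Closed geodesic with endpoints [x], [y] (distinct points of the circle, so
    that [L] is unique). *)
Definition geodesic x y : set (R * R) :=
  [set p | disk p /\ exists L, [/\ hyperbolic_line L, L x, L y & L p]].

Definition geodesics_cross x y a b : Prop :=
  geodesic x y <> geodesic a b /\
  exists p, [/\ dot p p < 1, geodesic x y p & geodesic a b p].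

(** [J] together with the bounded components of its complement. *)
Definition enclosed J : set (R * R) :=
  J `|` [set p | (~` J) p /\ bounded_set (connected_component (~` J) p)].

(** Points [w] of the circle near [p] lie on its counterclockwise side when
    [0 < cross p w], on its clockwise side when [cross p w < 0]. *)
Definition admissible Z : Prop :=
  [/\ Z `<=` circle,
      Z `<=` isolated Z,
      (forall p, circle p -> limit_point Z p ->
        limit_point (Z `&` [set w | 0 < cross p w]) p /\
        limit_point (Z `&` [set w | cross p w < 0]) p) &
      (`I_4 #<= Z)%card].

Section Successor.
Variable Z : set (R * R).

(** [y = x^+], equivalently [x = y^-]. *)
Definition succ (x y : Z) : Prop :=
  x <> y /\ forall w : Z, ~ ccw (\val x) (\val w) (\val y).

(** [y] is none of [x], [x^+], [x^-]. *)
Definition diagonal (x y : Z) : Prop := [/\ y <> x, ~ succ x y & ~ succ y x].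

End Successor.
End Plane.

Arguments circle : clear implicits.
Arguments disk : clear implicits.

(** * Linear categories with a shift *)

Record shiftCategory (k : fieldType) := ShiftCategory {
  ob :> Type;
  Hom : ob -> ob -> lmodType k;
  idm : forall X, Hom X X;
  comp : forall X Y W, Hom Y W -> Hom X Y -> Hom X W;
  comp_linear_l : forall X Y W (f : Hom X Y), linear (fun g : Hom Y W => comp g f);
  comp_linear_r : forall X Y W (g : Hom Y W), linear (fun f : Hom X Y => comp g f);
  comp_id_l : forall X Y (f : Hom X Y), comp (idm Y) f = f;
  comp_id_r : forall X Y (f : Hom X Y), comp f (idm X) = f;
  comp_assoc : forall X Y W V (h : Hom W V) (g : Hom Y W) (f : Hom X Y),
    comp h (comp g f) = comp (comp h g) f;
  shift : ob -> ob;
  shift_hom : forall X Y, Hom X Y -> Hom (shift X) (shift Y);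
  shift_linear : forall X Y, linear (@shift_hom X Y);
  shift_id : forall X, shift_hom (idm X) = idm (shift X);
  shift_comp : forall X Y W (g : Hom Y W) (f : Hom X Y),
    shift_hom (comp g f) = comp (shift_hom g) (shift_hom f)
}.

Section ShiftCategoryTheory.
Context {k : fieldType} {C : shiftCategory k}.
Implicit Types X Y A B : C.

Definition isomorphic X Y : Prop :=
  exists (f : Hom X Y) (g : Hom Y X), comp g f = idm X /\ comp f g = idm Y.

Definition is_zero X : Prop := idm X = 0.

Definition is_biproduct X A B : Prop :=
  exists (iA : Hom A X) (iB : Hom B X) (pA : Hom X A) (pB : Hom X B),
  [/\ comp pA iA = idm A, comp pB iB = idm B,
      comp pA iB = 0, comp pB iA = 0 & comp iA pA + comp iB pB = idm X].

Definition indecomposable X : Prop :=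
  ~ is_zero X /\ forall A B, is_biproduct X A B -> is_zero A \/ is_zero B.

Definition Ext1 X Y : lmodType k := Hom X (shift Y).

Definition compatible X Y : Prop :=
  (forall e : Ext1 X Y, e = 0) /\ (forall e : Ext1 Y X, e = 0).

Definition compatible_family (S : set C) : Prop :=
  S `<=` indecomposable /\
  forall X Y, S X -> S Y -> X <> Y -> compatible X Y /\ ~ isomorphic X Y.

Definition is_cluster (S : set C) : Prop :=
  compatible_family S /\
  forall T, compatible_family T -> S `<=` T -> T = S.

End ShiftCategoryTheory.

(** The category [C_can(Z)], through the description of its indecomposable
    objects and of their compatibility.  [E x y] is only meaningful when
    [diagonal x y]. *)
Record canonicalCategory (R : realType) (k : fieldType) (Z : set (R * R)) :=
  CanonicalCategory {
  ccat :> shiftCategory k;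
  E : Z -> Z -> ccat;
  indecomposableP : forall X : ccat,
    indecomposable X <-> exists x y, diagonal x y /\ isomorphic X (E x y);
  isomorphic_E : forall x y a b, diagonal x y -> diagonal a b ->
    (isomorphic (E x y) (E a b) <-> (x = a /\ y = b) \/ (x = b /\ y = a));
  compatible_E : forall x y a b, diagonal x y -> diagonal a b ->
    (compatible (E x y) (E a b) <->
     ~ geodesics_cross (\val x) (\val y) (\val a) (\val b))
}.

(** * Geometric realization of an abstract simplicial complex *)

Section Realization.
Context (R : realType) {V : choiceType}.
Implicit Types (K : set (set V)) (s : set V).

(** Points of the realization, given by their barycentric coordinates. *)
Record realization K := Realization {
  bary : {ptws V -> R};
  bary_ge0 : forall v, 0 <= bary v;
  bary_simplex : K [set v | bary v != 0];
  bary_sum : \sum_(v \in [set: V]) bary v = 1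
}.

HB.instance Definition _ K := gen_eqMixin (realization K).
HB.instance Definition _ K := gen_choiceMixin (realization K).

Definition support K (q : realization K) : set V := [set v | bary q v != 0].

Definition closed_simplex K s : set (realization K) :=
  [set q | support q `<=` s].

Definition simplex_boundary K s : set (realization K) :=
  [set q | support q `<` s].

Arguments closed_simplex : clear implicits.
Arguments simplex_boundary : clear implicits.

(** Weak topology: a set is open iff its trace on every closed simplex is open
    for the usual (Euclidean) topology of that simplex, which is the one given
    by the barycentric coordinates. *)
Definition realization_open K (U : set (realization K)) : Prop :=
  forall s, K s -> exists W : set {ptws V -> R},
    open W /\ U `&` closed_simplex K s = (@bary K @^-1` W) `&` closed_simplex K s.

Lemma realization_openT K : realization_open [set: realization K].
Proof. by move=> s _; exists setT; split; [exact: openT|]. Qed.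

Lemma realization_openI K : setI_closed (@realization_open K).
Proof.
move=> A B oA oB s Ks.
have [W [oW eW]] := oA s Ks; have [W' [oW' eW']] := oB s Ks.
exists (W `&` W'); split; first exact: openI.
by rewrite preimage_setI -[in LHS](setIid (closed_simplex K s)) setIACA eW eW'
  -setIACA setIid.
Qed.

Lemma realization_open_bigcup K (I : Type) (f : I -> set (realization K)) :
  (forall i, realization_open (f i)) -> realization_open (\bigcup_i f i).
Proof.
move=> of_ s Ks.
have /choice[W hW] : forall i, exists W : set {ptws V -> R}, open W /\
    f i `&` closed_simplex K s = (@bary K @^-1` W) `&` closed_simplex K s.
  by move=> i; exact: of_.
exists (\bigcup_i W i); split; first by apply: bigcup_open => i _; case: (hW i).
by rewrite preimage_bigcup !setI_bigcupl; apply: eq_bigcupr => i _; case: (hW i).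
Qed.

HB.instance Definition _ K := @isOpenTopological.Build (realization K)
  (@realization_open K) (@realization_openT K) (@realization_openI K)
  (@realization_open_bigcup K).

End Realization.

Arguments closed_simplex R {V} K s.
Arguments simplex_boundary R {V} K s.

(** * Homeomorphisms between subsets *)

Definition homeomorphism_onto (T U : topologicalType) (A : set T) (B : set U)
    (f : T -> U) : Prop :=
  exists g : U -> T, [/\ {within A, continuous f}, {within B, continuous g},
    f @` A = B & forall x, A x -> g (f x) = x].

(** * The complex [K(S)] and the map [psi_S] *)

Section ClusterComplex.
Context (R : realType) (k : fieldType) (Z : set (R * R)).
Context (C : canonicalCategory k Z) (S : set C).

Definition in_up_to_iso (x y : Z) : Prop :=
  diagonal x y /\ exists2 X : C, S X & isomorphic X (E C x y).

Definition locally_finite : Prop := forall x : Z,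
  finite_set [set X | S X /\ exists y, diagonal x y /\ isomorphic X (E C x y)].

Definition edge (x y : Z) : Prop := [\/ in_up_to_iso x y, succ x y | succ y x].

Definition triangle (x y z : Z) : Prop := [/\ edge x y, edge y z & edge x z].

(** [edge] is irreflexive, so the three kinds of simplices have exactly one,
    two and three vertices. *)
Definition clusterK : set (set Z) :=
  [set s | [\/ exists x, s = [set x],
               exists x y, edge x y /\ s = [set x; y]
             | exists x y z, triangle x y z /\ s = [set x; y; z]]].

Definition is_psi (psi : realization R clusterK -> disk R) : Prop :=
  let f : realization R clusterK -> R * R := fun q => \val (psi q) in
  let simplex := closed_simplex R clusterK in
  [/\ forall x q, simplex [set x] q -> f q = \val x,
      forall x y, succ x y ->
        homeomorphism_onto (simplex [set x; y]) (arc (\val x) (\val y)) f,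
      forall x y, in_up_to_iso x y ->
        homeomorphism_onto (simplex [set x; y]) (geodesic (\val x) (\val y)) f &
      forall x y z, triangle x y z ->
        homeomorphism_onto (simplex [set x; y; z])
          (enclosed (f @` simplex_boundary R clusterK [set x; y; z])) f].

End ClusterComplex.

(* Main.v *)
(** The map [klein] p |-> 2p/(1+|p|^2) takes the Poincare disk to the Klein disk,
    fixing the circle and turning geodesics into chords. The geodesic from [x]
    to [y] is thus [orient x y (klein p) = 0], and the region enclosed by the
    boundary of a triangle of the complex is cut out of the disk by the
    conditions [orient x y (klein p) >= 0], one for each side [xy] in the cluster
    (a side {z, z^+} gives none).

    Injectivity: since elements of the cluster do not cross, the open arcs,
    geodesics and triangles are pairwise disjoint, so the image of a point
    determines the open simplex containing it. Continuity is checked on each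
    simplex.

    If [x] has infinitely many neighbours [y_n], choose on each edge {x, y_n} a
    point whose image lies within 1/(n+1) of [x]. These points form a closed set
    for the weak topology, so the inverse of the map is not continuous at [x].

    Conversely, if [z] has finitely many neighbours, maximality of the cluster
    shows that consecutive neighbours [y], [y'] of [z] are joined by an edge. The
    triangles [z y y'] then cover the part of the disk on the side of [z] of the
    finitely many geodesics [y y'], so the map is open near the star of [z]. *)

Require Import Defs.
From mathcomp Require Import all_boot all_order all_algebra.
From mathcomp Require Import all_classical all_reals all_analysis.
From mathcomp Require Import ring lra.
Import Order.TTheory GRing.Theory Num.Theory.
Import numFieldNormedType.Exports.
Local Open Scope classical_set_scope.
Local Open Scope ring_scope.

(** * Orientation of triples and the Klein model *)

Section PlaneLemmas.
Context {R : realType}.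
Implicit Types (x y z a b c k p q : R * R).

(** All incidence questions become questions about signs of the affine functions [orient x y] on the
    Klein disk. In the Plücker relation the coefficients [lam] are nonnegative there, so the cyclic
    order of points of the circle turns into inclusions of half disks; transitivity of [ccw] and
    disjointness of the cells both come from it.

    The image of a 2-simplex is given only topologically, through [enclosed]. It is computed by
    hand: a point violating one of the sign conditions is joined to infinity by explicit segments
    and rays that avoid the boundary curve, while the open triangle is clopen in the complement of
    that curve.

    Admissibility enters through successors and predecessors. Seen from [z], the rest of [Z] becomes
    a bounded subset of the real line, because [z] is isolated, and its extreme values are attained,
    because limits are two-sided. Successors put every vertex on an edge; together with predecessors
    they close the star of [z] at both ends, where the triangles reach the circle along arcs. *)

Definition orient x y k : R := cross (y - x) (k - x).

(* Proportional to the distance from [k] to the tangent of the circle at [x];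
   positive on the closed disk except at [x]. *)
Definition lam k x : R := 1 - dot k x.

Lemma circleE x : circle R x -> x.1 * x.1 = 1 - x.2 * x.2.
Proof. by rewrite /circle /dot /=; lra. Qed.

Lemma circle_disk x : circle R x -> dot x x <= 1.
Proof. by rewrite /circle /= => ->. Qed.

Lemma orientC x y k : orient x y k = orient y k x.
Proof. by rewrite /orient /cross /=; ring. Qed.

Lemma orient_swap x y k : orient y x k = - orient x y k.
Proof. by rewrite /orient /cross /=; ring. Qed.

Lemma orientxx x k : orient x x k = 0.
Proof. by rewrite /orient /cross /=; ring. Qed.

Lemma orientl x y : orient x y x = 0.
Proof. by rewrite /orient /cross /=; ring. Qed.

Lemma orientr x y : orient x y y = 0.
Proof. by rewrite /orient /cross /=; ring. Qed.

Lemma lamC x y : lam x y = lam y x.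
Proof. by rewrite /lam /dot; ring. Qed.

(* Plücker relation: [lam _ x] is linear in the vector [_ - x]. *)
Lemma orient_pluecker x a y k : circle R x ->
  lam a x * orient x y k = lam y x * orient x a k - lam k x * orient x a y.
Proof. by move=> /circleE hx; rewrite /lam /orient /cross /dot /=; ring: hx. Qed.

(** This is the formula area = abc/(4r) for a triangle inscribed in a circle of radius r = 1:
    [orient] is twice the signed area and [2 * lam x y] is the squared length of the chord [xy]. It
    shows that three distinct points of the circle are never collinear. *)
Lemma orient_sqr x y z : circle R x -> circle R y -> circle R z ->
  orient x y z ^+ 2 = 2 * (lam x y * lam y z * lam x z).
Proof.
move=> /circleE hx /circleE hy /circleE hz.
by rewrite /lam /orient /cross /dot /=; ring: hx hy hz.
Qed.

Lemma pair_dist0 x y : (x.1 - y.1) ^+ 2 + (x.2 - y.2) ^+ 2 = 0 -> x = y.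
Proof.
move/eqP; rewrite paddr_eq0 ?sqr_ge0// !sqrf_eq0 !subr_eq0 => /andP[/eqP h1 /eqP h2].
by case: x y h1 h2 => [? ?] [? ?] /= -> ->.
Qed.

Lemma lam_ge0 k x : circle R x -> dot k k <= 1 -> 0 <= lam k x.
Proof.
move=> /circleE hx; rewrite /lam /dot => hk.
have := sqr_ge0 (k.1 - x.1); have := sqr_ge0 (k.2 - x.2); rewrite !sqrrB !expr2 !mulr2n; lra.
Qed.

(** For [k] in the disk the squared distance from [k] to [x] is at most [2 * lam k x], so
    [lam k x = 0] forces [k = x]. *)
Lemma lam_gt0 k x : circle R x -> dot k k <= 1 -> k <> x -> 0 < lam k x.
Proof.
move=> cx hk kx; rewrite lt_neqAle lam_ge0// andbT; apply/eqP => l0; apply: kx.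
apply: pair_dist0; move: (circleE _ cx) hk l0; rewrite /lam /dot => hx hk l0.
apply/eqP; rewrite eq_le; apply/andP; split.
  by rewrite !sqrrB !expr2 !mulr2n; lra.
by rewrite addr_ge0// sqr_ge0.
Qed.

Lemma lam_gt0_int k x : circle R x -> dot k k < 1 -> 0 < lam k x.
Proof.
move=> cx hk; apply: lam_gt0 => //; first exact: ltW.
by move=> kx; move: cx; rewrite -kx /circle /= => h; rewrite h ltxx in hk.
Qed.

Lemma orient_neq0 x y z : circle R x -> circle R y -> circle R z ->
  x <> y -> y <> z -> x <> z -> orient x y z != 0.
Proof.
move=> cx cy cz xy yz xz; rewrite -sqrf_eq0 orient_sqr// gt_eqF// !mulr_gt0//;
  by apply: lam_gt0 => //; exact: circle_disk.
Qed.

Lemma orient0 x y z : circle R x -> circle R y -> circle R z -> x <> y ->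
  orient x y z = 0 -> z = x \/ z = y.
Proof.
move=> cx cy cz xy o0; apply: contrapT => /not_orP[zx zy].
have /eqP := orient_neq0 x y z cx cy cz xy (nesym zy) (nesym zx); exact.
Qed.

Lemma ccwE x y z : ccw x y z = (0 < orient x y z) :> Prop.
Proof. by []. Qed.

Lemma ccwC x y z : ccw x y z -> ccw y z x.
Proof. by rewrite !ccwE orientC. Qed.

Lemma ccw_asym x y z : ccw x y z -> ~ ccw y x z.
Proof. by rewrite !ccwE (orient_swap x) oppr_gt0 => h; apply/negP; rewrite -leNgt ltW. Qed.

Lemma ccw_asymr x y z : ccw x y z -> ~ ccw x z y.
Proof. by move=> h /ccwC/ccwC h'; exact: (ccw_asym _ _ _ h h'). Qed.

Lemma ccw_neq x y z : ccw x y z -> [/\ x <> y, y <> z & x <> z].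
Proof.
rewrite ccwE => h; split=> e; subst; move: h;
  by rewrite ?orientxx ?orientl ?orientr ltxx.
Qed.

Lemma ccw_total x y z : circle R x -> circle R y -> circle R z ->
  x <> y -> y <> z -> x <> z -> ccw x y z \/ ccw x z y.
Proof.
move=> cx cy cz xy yz xz; rewrite !ccwE [orient x z y]orientC [orient z y x]orientC.
rewrite (orient_swap x) oppr_gt0.
have := orient_neq0 x y z cx cy cz xy yz xz.
by rewrite neq_lt => /orP[]; [right|left].
Qed.

(** The Plücker relation at [z] writes [lam b z * orient z a c] as a combination of [orient z a b]
    and [orient z b c] with positive coefficients [lam c z] and [lam a z]. *)
Lemma ccw_trans z a b c : circle R z -> circle R a -> circle R b -> circle R c ->
  ccw z a b -> ccw z b c -> ccw z a c.
Proof.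
move=> cz ca cb cc zab zbc.
have [za ab zb] := ccw_neq _ _ _ zab; have [_ bc zc] := ccw_neq _ _ _ zbc.
have la : 0 < lam a z by apply: lam_gt0 => //; [exact: circle_disk|exact: nesym].
have lb : 0 < lam b z by apply: lam_gt0 => //; [exact: circle_disk|exact: nesym].
have lc : 0 < lam c z by apply: lam_gt0 => //; [exact: circle_disk|exact: nesym].
have := orient_pluecker z b a c cz.
rewrite [orient z b a]orientC [orient b a z]orient_swap -[orient a b z]orientC.
move: zab zbc; rewrite !ccwE => zab zbc h.
by rewrite -(pmulr_rgt0 _ lb) h mulrN opprK addr_gt0// mulr_gt0.
Qed.

(* Seen from [z], [a] comes before [b] before [c]. *)
Lemma ccw_rebase z a b c : circle R z -> circle R a -> circle R b -> circle R c ->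
  ccw z a b -> ccw z b c -> ccw a b c.
Proof.
move=> cz ca cb cc /ccwC/ccwC bza /ccwC bcz.
by apply/ccwC/ccwC; exact: (ccw_trans b c z a).
Qed.

(* [half_disk_l] and [half_disk_r]: the half disk cut off by the chord [xy]
   contains those cut off by [ay] and by [xa]. *)
Section HalfDisk.
Variables (x a y k : R * R).
Hypotheses (cx : circle R x) (ca : circle R a) (cy : circle R y).
Hypotheses (hk : dot k k <= 1) (xay : ccw x a y).

Lemma half_disk_l : lam a y * orient x y k <= lam x y * orient a y k.
Proof.
have := orient_pluecker y a x k cy.
rewrite [orient y x k]orient_swap [orient y a k]orient_swap.
rewrite [orient y a x]orientC [orient a x y]orient_swap.
have := lam_ge0 k y cy hk; move: xay; rewrite ccwE => h1 h2 h3.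
have : 0 <= lam k y * orient x a y by rewrite mulr_ge0// ltW.
by move: h3; nra.
Qed.

Lemma half_disk_r : lam a x * orient x y k <= lam y x * orient x a k.
Proof.
rewrite (orient_pluecker x a y k cx) lerBlDr lerDl mulr_ge0 ?lam_ge0//.
by move: xay; rewrite ccwE => /ltW.
Qed.

Let lay : 0 < lam a y.
Proof. by have [_ ? _] := ccw_neq _ _ _ xay; apply: lam_gt0 => //; exact: circle_disk. Qed.
Let lxy : 0 < lam x y.
Proof. by have [_ _ ?] := ccw_neq _ _ _ xay; apply: lam_gt0 => //; exact: circle_disk. Qed.
Let lax : 0 < lam a x.
Proof. by have [/nesym ? _ _] := ccw_neq _ _ _ xay; apply: lam_gt0 => //; exact: circle_disk. Qed.

Lemma half_disk_l_le : orient a y k <= 0 -> orient x y k <= 0.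
Proof.
move=> h; rewrite -(pmulr_rle0 _ lay); apply: le_trans half_disk_l _.
by rewrite pmulr_rle0.
Qed.

Lemma half_disk_l_lt : orient a y k < 0 -> orient x y k < 0.
Proof.
move=> h; rewrite -(pmulr_rlt0 _ lay); apply: le_lt_trans half_disk_l _.
by rewrite pmulr_rlt0.
Qed.

Lemma half_disk_r_le : orient x a k <= 0 -> orient x y k <= 0.
Proof.
move=> h; rewrite -(pmulr_rle0 _ lax); apply: le_trans half_disk_r _.
by rewrite pmulr_rle0// lamC.
Qed.

Lemma half_disk_r_lt : orient x a k < 0 -> orient x y k < 0.
Proof.
move=> h; rewrite -(pmulr_rlt0 _ lax); apply: le_lt_trans half_disk_r _.
by rewrite pmulr_rlt0// lamC.
Qed.

Hypothesis hki : dot k k < 1.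

(** The chords [ay] and [xy] meet only at [y], which is on the circle. At an interior point the
    Plücker term [lam k y * orient x a y] is positive, and this makes the conclusion strict. *)
Lemma half_disk_l_int : orient a y k <= 0 -> orient x y k < 0.
Proof.
move=> h; rewrite -(pmulr_rlt0 _ lay).
have := orient_pluecker y a x k cy.
rewrite [orient y x k]orient_swap [orient y a k]orient_swap.
rewrite [orient y a x]orientC [orient a x y]orient_swap.
have h1 := lam_gt0_int k y cy hki; move: xay; rewrite ccwE => h2.
have := mulr_gt0 h1 h2; have := mulr_ge0_le0 (ltW lxy) h; nra.
Qed.

Lemma half_disk_r_int : orient x a k <= 0 -> orient x y k < 0.
Proof.
move=> h; rewrite -(pmulr_rlt0 _ lax) (orient_pluecker x a y k cx).
have h1 := lam_gt0_int k x cx hki; move: xay; rewrite ccwE => h2.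
have := mulr_gt0 h1 h2; have := mulr_ge0_le0 (ltW lxy) h; rewrite (lamC x y); nra.
Qed.

End HalfDisk.

Definition klein p : R * R :=
  (2 * p.1 / (1 + dot p p), 2 * p.2 / (1 + dot p p)).

Lemma dot_ge0 p : 0 <= dot p p.
Proof. by rewrite /dot addr_ge0// -expr2 sqr_ge0. Qed.

Lemma dot1_gt0 p : 0 < 1 + dot p p.
Proof. by rewrite ltr_wpDr// dot_ge0. Qed.

Lemma dot_klein p :
  dot (klein p) (klein p) = 1 - ((1 - dot p p) / (1 + dot p p)) ^+ 2.
Proof.
have := dot1_gt0 p; rewrite /klein /dot /= => /lt0r_neq0 h; field; exact: h.
Qed.

Lemma klein_disk p : dot (klein p) (klein p) <= 1.
Proof. by rewrite dot_klein gerBl sqr_ge0. Qed.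

Lemma klein_circle p : circle R p -> klein p = p.
Proof.
rewrite /circle /= => h; rewrite /klein h; case: p h => p1 p2 /= _.
by rewrite -[1 + 1]/(2%:R) ![2 * _]mulrC !mulfK// pnatr_eq0.
Qed.

Lemma klein_int p : dot p p < 1 -> dot (klein p) (klein p) < 1.
Proof.
move=> h; rewrite dot_klein gtrBl exprn_gt0// divr_gt0 ?subr_gt0//; exact: dot1_gt0.
Qed.

(* The polynomial form of [orient x y (klein p)], whose sign also makes sense
   along rays leaving the disk. *)
Definition side x y p : R := 2 * cross (y - x) p + (1 + dot p p) * cross x y.

Lemma sideE x y p : side x y p = (1 + dot p p) * orient x y (klein p).
Proof.
have := lt0r_neq0 (dot1_gt0 p).
rewrite /side /orient /klein /cross /dot /= => h; field; exact: h.
Qed.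

(** The inverse of [klein] on the disk: the root of modulus at most 1 of the quadratic equation
    defining [klein]. Outside the disk [Num.sqrt] returns 0, so the map is the identity there and is
    continuous on the whole plane. *)
Definition poincare k : R * R :=
  (k.1 / (1 + Num.sqrt (1 - dot k k)), k.2 / (1 + Num.sqrt (1 - dot k k))).

Lemma dot_poincare k : dot k k <= 1 ->
  dot (poincare k) (poincare k) =
  (1 - Num.sqrt (1 - dot k k)) / (1 + Num.sqrt (1 - dot k k)).
Proof.
move=> hk; have := sqr_sqrtr (a := 1 - dot k k); rewrite subr_ge0 => /(_ hk).
rewrite /poincare; have := sqrtr_ge0 (1 - dot k k); move: (Num.sqrt _) => s s0.
rewrite /dot /= => e; have s1 : 1 + s != 0 by apply: lt0r_neq0; lra.
have -> : k.1 / (1 + s) * (k.1 / (1 + s)) + k.2 / (1 + s) * (k.2 / (1 + s)) =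
  (k.1 * k.1 + k.2 * k.2) / (1 + s) ^+ 2 by field.
have -> : k.1 * k.1 + k.2 * k.2 = 1 - s ^+ 2 by lra.
by field.
Qed.

Lemma poincare_disk k : dot k k <= 1 -> disk R (poincare k).
Proof.
move=> hk; rewrite /disk /= dot_poincare//.
have := sqrtr_ge0 (1 - dot k k) => s0.
by rewrite ler_pdivrMr; lra.
Qed.

Lemma poincare_int k : dot k k < 1 -> dot (poincare k) (poincare k) < 1.
Proof.
move=> hk; rewrite dot_poincare ?ltW//.
have : 0 < Num.sqrt (1 - dot k k) by rewrite sqrtr_gt0 subr_gt0.
by move=> s0; rewrite ltr_pdivrMr; lra.
Qed.

Lemma poincareK k : dot k k <= 1 -> klein (poincare k) = k.
Proof.
move=> hk; rewrite /klein dot_poincare// /poincare.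
have := sqrtr_ge0 (1 - dot k k); move: (Num.sqrt _) => s s0.
have s1 : 1 + s != 0 by apply: lt0r_neq0; lra.
by case: k hk => k1 k2 hk /=; congr pair; field; lra.
Qed.

Lemma poincare_circle k : circle R k -> poincare k = k.
Proof.
rewrite /circle /poincare /= => ->; rewrite subrr sqrtr0 addr0 !divr1.
by case: k.
Qed.

(** The circle of centre [c] orthogonal to the unit circle has equation [2 * dot p c = 1 + dot p p],
    that is [dot (klein p) c = 1]: the image under [klein] lies on the polar line of [c], which is
    the chord [xy]. *)
Lemma geodesicP x y p : circle R x -> circle R y -> x <> y ->
  geodesic x y p <-> disk R p /\ orient x y (klein p) = 0.
Proof.
move=> cx cy xy.
have d1 := lt0r_neq0 (dot1_gt0 p).
have s0 : orient x y (klein p) = 0 <-> side x y p = 0.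
  rewrite sideE; split=> [->|/eqP]; first by rewrite mulr0.
  by rewrite mulf_eq0 (negPf d1) => /eqP.
rewrite s0; split=> -[dp].
  move=> [L [[[c [cc ->]]|[u [u0 ->]]]]] /= hx hy hp; split=> //.
    have ex : dot x c = 1 by move: (circleE _ cx) hx; rewrite /dot /=; lra.
    have ey : dot y c = 1 by move: (circleE _ cy) hy; rewrite /dot /=; lra.
    have ep : 2 * dot p c = 1 + dot p p by move: hp; rewrite /dot /=; lra.
    (* Both coordinates of [c] times [side x y p] are combinations of the three equations just
       derived, and [c] is nonzero because [1 < dot c c]. The same scheme with the normal [u]
       handles the diameters. *)
    have h1 : c.1 * side x y p = 0.
      have -> : c.1 * side x y p = (y.2 - x.2) * (1 + dot p p - 2 * dot p c)
        + (p.2 - x.2 * (1 + dot p p)/2) * (2 * dot y c - 2 * dot x c)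
        + (x.2 * (1 + dot p p) / 2 *2 - x.2 * (1+dot p p)) * 0
        + (y.2 - x.2) * (1 + dot p p) * (dot x c - 1).
        by rewrite /side /cross /dot /=; field.
      by rewrite !ex !ey ep; field.
    have h2 : c.2 * side x y p = 0.
      have -> : c.2 * side x y p = - (y.1 - x.1) * (1 + dot p p - 2 * dot p c)
        - (p.1 - x.1 * (1 + dot p p)/2) * (2 * dot y c - 2 * dot x c)
        - (y.1 - x.1) * (1 + dot p p) * (dot x c - 1).
        by rewrite /side /cross /dot /=; field.
      by rewrite !ex !ey ep; field.
    apply/eqP; rewrite -[_ == 0]orbF.
    have : dot c c * side x y p = 0.
      by rewrite /dot mulrDl -!mulrA h1 h2 !mulr0 addr0.
    move/eqP; rewrite mulf_eq0 => /orP[/eqP c0|->//].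
    by move: cc; rewrite c0; lra.
  have h1 : u.1 * side x y p = 0.
    have -> : u.1 * side x y p = 2 * (y.2 - x.2) * (- dot u p)
      + 2 * p.2 * (dot u y - dot u x) + (1 + dot p p) * (y.2 * dot u x - x.2 * dot u y).
      by rewrite /side /cross /dot /=; ring.
    by rewrite hx hy hp; ring.
  have h2 : u.2 * side x y p = 0.
    have -> : u.2 * side x y p = 2 * (y.1 - x.1) * dot u p
      - 2 * p.1 * (dot u y - dot u x) + (1 + dot p p) * (- y.1 * dot u x + x.1 * dot u y).
      by rewrite /side /cross /dot /=; ring.
    by rewrite hx hy hp; ring.
  apply/eqP/negPn/negP => sn; apply: u0.
  move/eqP: h1; move/eqP: h2; rewrite !mulf_eq0 (negPf sn) !orbF => /eqP h2 /eqP h1.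
  by case: u {hx hy hp} h1 h2 => ? ? /= -> ->.
move=> hs; split=> //.
(* The diametral case: [y] is opposite to [x], there is no pole, and the carrier is the line through
   the origin whose normal is [x] turned by a right angle. *)
have [cr0|cr0] := eqVneq (cross x y) 0.
  have yx : y = (- x.1, - x.2).
    have : (x.1 * y.1 + x.2 * y.2 - 1) * (x.1 * y.1 + x.2 * y.2 + 1) = 0.
      have : (x.1 * y.2 - x.2 * y.1) ^+ 2 = 0 by rewrite -/(cross x y) cr0 expr0n.
      have h := circleE _ cx; have h' := circleE _ cy => e.
      by rewrite -[RHS]oppr0 -e; ring: h h'.
    move/eqP; rewrite mulf_eq0 => /orP[] /eqP e.
      exfalso; apply: xy; apply: pair_dist0.
      by move: (circleE _ cx) (circleE _ cy); rewrite !expr2; nra.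
    apply: pair_dist0 => /=.
    by move: (circleE _ cx) (circleE _ cy); rewrite !expr2; nra.
  exists [set q | dot (- x.2, x.1) q = 0]; split => /=.
  - right; exists (- x.2, x.1); split=> // -[e1 e2].
    by move: (circleE _ cx); rewrite e2 (_ : x.2 = 0); lra.
  - by rewrite /dot /=; ring.
  - by rewrite yx /dot /=; ring.
  - move: hs; rewrite /side cr0 yx /cross /dot /=; lra.
(* the pole of the chord [xy] *)
pose c : R * R := ((y.2 - x.2) / cross x y, - (y.1 - x.1) / cross x y).
have hc q : dot (q - c) (q - c) - (dot c c - 1) = side x y q / cross x y.
  rewrite /side -[X in _ = X]/((2 * cross (y - x) q + _) / _) mulrDl mulfK//.
  by rewrite /dot /c /=; rewrite [cross (y - x) q]/cross /=; field.
have sl : side x y x = 0 by rewrite sideE klein_circle// orientl mulr0.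
have sr : side x y y = 0 by rewrite sideE klein_circle// orientr mulr0.
have hq q : side x y q = 0 -> dot (q - c) (q - c) = dot c c - 1.
  by move=> e; apply/eqP; rewrite -subr_eq0 hc e mul0r.
exists [set q | dot (q - c) (q - c) = dot c c - 1]; split; [|exact: hq..].
left; exists c; split=> //.
have lxy : 0 < lam x y by apply: lam_gt0 => //; exact: circle_disk.
have -> : dot c c = 2 * lam x y / cross x y ^+ 2.
  move: (circleE _ cx) (circleE _ cy) => ex ey.
  rewrite /dot /c /=.
  have -> : 2 * lam x y = (y.2 - x.2)^+2 + (y.1 - x.1)^+2.
    by rewrite /lam /dot; ring: ex ey.
  by field.
rewrite ltr_pdivlMr ?exprn_even_gt0//= mul1r.
(* Lagrange's identity [cross x y ^+ 2 + dot x y ^+ 2 = 1], with [dot x y = 1 - lam x y]. *)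
have -> : cross x y ^+ 2 = 2 * lam x y - lam x y ^+ 2.
  move: (circleE _ cx) (circleE _ cy) => ex ey.
  by rewrite /lam /dot /cross; ring: ex ey.
by rewrite gtrBl exprn_gt0.
Qed.

End PlaneLemmas.

(** * Crossing of geodesics *)

Section Chords.
Context {R : realType}.
Implicit Types (x y z a b c d k p q : R * R) (t : R).

Definition chord_point c d t : R * R :=
  (c.1 + t * (d.1 - c.1), c.2 + t * (d.2 - c.2)).

(** The power of the point with respect to the circle: for [c <> d] the point is interior exactly
    when [0 < t < 1]. *)
Lemma dot_chord_point c d t : circle R c -> circle R d ->
  dot (chord_point c d t) (chord_point c d t) = 1 - 2 * (t * (1 - t)) * lam c d.
Proof.
by move=> /circleE hc /circleE hd; rewrite /dot /lam /dot /chord_point /=; ring: hc hd.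
Qed.

Lemma orient_chord_point x y c d t :
  orient x y (chord_point c d t) = (1 - t) * orient x y c + t * orient x y d.
Proof. by rewrite /orient /cross /chord_point /=; ring. Qed.

Lemma chord_pointP c d k : circle R c -> circle R d -> c <> d ->
  orient c d k = 0 -> exists t, k = chord_point c d t.
Proof.
move=> cc cd ncd o0.
have l0 : 0 < lam c d by apply: lam_gt0 => //; exact: circle_disk.
(* The parameter of the orthogonal projection of [k] to the chord; [2 * lam c d] is the squared
   length of [cd]. *)
exists (dot (k - c) (d - c) / (2 * lam c d)).
have e : 2 * lam c d = (d.1 - c.1) ^+ 2 + (d.2 - c.2) ^+ 2.
  by move: (circleE _ cc) (circleE _ cd) => hc hd; rewrite /lam /dot; ring: hc hd.
have n0 : (d.1 - c.1) ^+ 2 + (d.2 - c.2) ^+ 2 != 0 by rewrite -e lt0r_neq0// mulr_gt0.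
rewrite /chord_point e.
have oe : (d.1 - c.1) * (k.2 - c.2) - (d.2 - c.2) * (k.1 - c.1) = 0 by [].
suff [<- <-] : (k.1 - c.1) = dot (k - c) (d - c) / ((d.1 - c.1) ^+ 2 + (d.2 - c.2) ^+ 2) * (d.1 - c.1)
  /\ (k.2 - c.2) = dot (k - c) (d - c) / ((d.1 - c.1) ^+ 2 + (d.2 - c.2) ^+ 2) * (d.2 - c.2).
  by rewrite !subrKC; case: k {o0 oe}.
split; apply/eqP; rewrite -subr_eq0; apply/eqP.
  have -> : k.1 - c.1 - dot (k - c) (d - c) / ((d.1 - c.1) ^+ 2 + (d.2 - c.2) ^+ 2) * (d.1 - c.1) =
   - (d.2 - c.2) * ((d.1 - c.1) * (k.2 - c.2) - (d.2 - c.2) * (k.1 - c.1)) / ((d.1 - c.1) ^+ 2 + (d.2 - c.2) ^+ 2).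
    by rewrite /dot /=; field.
  by rewrite oe mulr0 mul0r.
have -> : k.2 - c.2 - dot (k - c) (d - c) / ((d.1 - c.1) ^+ 2 + (d.2 - c.2) ^+ 2) * (d.2 - c.2) =
   (d.1 - c.1) * ((d.1 - c.1) * (k.2 - c.2) - (d.2 - c.2) * (k.1 - c.1)) / ((d.1 - c.1) ^+ 2 + (d.2 - c.2) ^+ 2).
  by rewrite /dot /=; field.
by rewrite oe mulr0 mul0r.
Qed.

Lemma geodesic_endl x y : circle R x -> circle R y -> x <> y -> geodesic x y x.
Proof.
move=> cx cy xy; apply/geodesicP => //; split; first exact: circle_disk.
by rewrite klein_circle// orientl.
Qed.

Lemma geodesic_endr x y : circle R x -> circle R y -> x <> y -> geodesic x y y.
Proof.
move=> cx cy xy; apply/geodesicP => //; split; first exact: circle_disk.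
by rewrite klein_circle// orientr.
Qed.

Lemma geodesic_circle x y p : circle R x -> circle R y -> x <> y ->
  geodesic x y p -> circle R p -> p = x \/ p = y.
Proof.
move=> cx cy xy /geodesicP -/(_ cx cy xy)[_ +] cp; rewrite klein_circle//.
exact: orient0.
Qed.

Lemma geodesicC x y : circle R x -> circle R y -> x <> y ->
  geodesic x y = geodesic y x.
Proof.
move=> cx cy xy; apply/seteqP; split=> p.
  move=> /geodesicP -/(_ cx cy xy)[dp o0]; apply/geodesicP => //; first exact: nesym.
  by rewrite orient_swap o0 oppr0.
move=> /geodesicP -/(_ cy cx (nesym xy))[dp o0]; apply/geodesicP => //.
by rewrite orient_swap o0 oppr0.
Qed.

Lemma geodesic_inj x y a b : circle R x -> circle R y -> x <> y ->
  circle R a -> circle R b -> a <> b -> geodesic x y = geodesic a b ->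
  (x = a /\ y = b) \/ (x = b /\ y = a).
Proof.
move=> cx cy xy ca cb ab e.
have := geodesic_endl a b ca cb ab; rewrite -e => /geodesic_circle -/(_ cx cy xy ca).
have := geodesic_endr a b ca cb ab; rewrite -e => /geodesic_circle -/(_ cx cy xy cb).
by move=> [eb|eb] [ea|ea]; subst; [case: ab|right|left|case: ab].
Qed.

Lemma orient_perm x a y : orient x y a = - orient x a y.
Proof. by rewrite orientC orientC orient_swap. Qed.

Lemma ccw_cross x y a b : circle R x -> circle R y -> circle R a -> circle R b ->
  ccw x a y -> ccw y b x -> geodesics_cross x y a b.
Proof.
move=> cx cy ca cb xay ybx.
have [_ _ xy] := ccw_neq _ _ _ xay; have [_ bx yx] := ccw_neq _ _ _ ybx.
have oa : orient x y a < 0 by rewrite orient_perm oppr_lt0.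
have ob : 0 < orient x y b by rewrite orientC.
have ab : a <> b by move=> e; move: oa ob; rewrite e => /lt_trans h /h; rewrite ltxx.
have ga : geodesic a b a by exact: geodesic_endl.
split.
  move=> e; move: ga; rewrite -e => /geodesicP -/(_ cx cy xy)[_].
  by rewrite klein_circle// => h; rewrite h ltxx in oa.
(* The zero of the affine function [orient x y] along the chord [ab]. It lies strictly between 0 and
   1 because the values at [a] and [b] have opposite signs. *)
pose t := - orient x y a / (orient x y b - orient x y a).
have dn : 0 < orient x y b - orient x y a by rewrite subr_gt0 (lt_trans oa).
have t0 : 0 < t by rewrite divr_gt0// oppr_gt0.
have t1 : t < 1 by rewrite /t ltr_pdivrMr// mul1r; lra.
have l0 : 0 < lam a b by apply: lam_gt0 => //; exact: circle_disk.
pose k := chord_point a b t.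
have hk : dot k k < 1.
  by rewrite dot_chord_point// gtrBl mulr_gt0// mulr_gt0// mulr_gt0// subr_gt0.
have ok1 : orient x y k = 0.
  by rewrite orient_chord_point /t; field; rewrite lt0r_neq0.
have ok2 : orient a b k = 0 by rewrite orient_chord_point orientl orientr !mulr0 addr0.
exists (poincare k); split; first exact: poincare_int.
- by apply/geodesicP => //; rewrite poincareK ?ltW//; split=> //; exact/poincare_disk/ltW.
- by apply/geodesicP => //; rewrite poincareK ?ltW//; split=> //; exact/poincare_disk/ltW.
Qed.

(** The crossing point is interior to the chord [cd], so the affine function [orient x y], which
    vanishes there, takes opposite signs at [c] and [d] or vanishes at both; in the latter case the
    two geodesics coincide, which does not count as a crossing. *)
Lemma cross_ccw x y c d : circle R x -> circle R y -> circle R c -> circle R d ->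
  x <> y -> c <> d -> geodesics_cross x y c d ->
  (ccw x c y /\ ccw y d x) \/ (ccw x d y /\ ccw y c x).
Proof.
move=> cx cy cc cd xy ncd [ng [p [pi /geodesicP -/(_ cx cy xy)[_ o1]
  /geodesicP -/(_ cc cd ncd)[_ o2]]]].
have [t et] := chord_pointP _ _ _ cc cd ncd o2.
have := klein_int _ pi; rewrite et dot_chord_point//.
have l0 : 0 < lam c d by apply: lam_gt0 => //; exact: circle_disk.
rewrite gtrBl pmulr_lgt0// pmulr_rgt0// => t01.
move: o1; rewrite et orient_chord_point => o1.
have t0 : 0 < t by nra.
have t1 : 0 < 1 - t by nra.
have zero : orient x y c = 0 -> orient x y d = 0 -> False.
  move=> /(orient0 _ _ _ cx cy cc xy) ec /(orient0 _ _ _ cx cy cd xy) ed.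
  case: ec ed => ec [] ed; subst => //; apply: ng => //; exact: geodesicC.
have [h|h|h] := ltrgtP (orient x y c) 0.
- left; rewrite !ccwE -oppr_lt0 -orient_perm; split=> //.
  by rewrite -orientC; nra.
- right; rewrite !ccwE -oppr_lt0 -orient_perm; split; first by nra.
  by rewrite -orientC.
- by exfalso; apply: zero => //; move: o1; rewrite h mulr0 add0r => /eqP;
    rewrite mulf_eq0 gt_eqF//= => /eqP.
Qed.

Lemma arc_cases x y z a : circle R x -> circle R y -> circle R z -> circle R a ->
  ccw x y z -> [\/ a = x \/ a = y \/ a = z, ccw x a y, ccw y a z | ccw z a x].
Proof.
move=> cx cy cz ca xyz.
have [->|ax] := pselect (a = x); first by constructor 1; left.
have [->|ay] := pselect (a = y); first by constructor 1; right; left.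
have [->|az] := pselect (a = z); first by constructor 1; right; right.
have zxy := ccwC _ _ _ (ccwC _ _ _ xyz).
have [xy yz xz] := ccw_neq _ _ _ xyz.
have [zax|zxa] := ccw_total z a x cz ca cx (nesym az) ax (nesym xz).
  by constructor 4.
have [zay|zya] := ccw_total z a y cz ca cy (nesym az) ay (nesym yz).
  by constructor 2; exact: (ccw_rebase z x a y).
by constructor 3; exact: ccwC.
Qed.

End Chords.

(** * Geodesic triangles *)

Section Triangles.
Context {R : realType}.
Implicit Types (x y z a b c d k p q : R * R) (P Q S : Prop).

(* A side of a triangle of the complex; [P] tells whether it belongs to the
   cluster or joins an element of [Z] to its successor. *)
Definition curve P x y : set (R * R) :=
  [set p | (P /\ geodesic x y p) \/ (~ P /\ Defs.arc x y p)].

Definition closed_tri P Q S x y z : set (R * R) := [set p | [/\ disk R p,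
  P -> 0 <= orient x y (klein p), Q -> 0 <= orient y z (klein p) &
  S -> 0 <= orient z x (klein p)]].

Definition open_tri P Q S x y z : set (R * R) := [set p | [/\ dot p p < 1,
  P -> 0 < orient x y (klein p), Q -> 0 < orient y z (klein p) &
  S -> 0 < orient z x (klein p)]].

Lemma closed_tri_rot P Q S x y z : closed_tri P Q S x y z = closed_tri Q S P y z x.
Proof. by apply/seteqP; split=> p []. Qed.

Lemma disk_circle_or_int p : disk R p -> circle R p \/ dot p p < 1.
Proof. by rewrite /disk /circle /= le_eqVlt => /orP[/eqP|]; [left|right]. Qed.

(** Points beyond [yz] or [zx] lie strictly on the inner side of the chord [xy], so the geodesic
    [xy] avoids them. When the side is an arc, the cyclic order alone gives the signs. *)
Lemma curve_closed_tri P Q S x y z : circle R x -> circle R y -> circle R z ->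
  ccw x y z -> curve P x y `<=` closed_tri P Q S x y z.
Proof.
move=> cx cy cz xyz p.
have [xy yz xz] := ccw_neq _ _ _ xyz.
have yzx := ccwC _ _ _ xyz.
case=> [[hP /geodesicP -/(_ cx cy xy)[dp o0]]|[nP [cp hp]]].
  split=> //.
  - by rewrite o0.
  - move=> _; rewrite leNgt; apply/negP => h.
    have := half_disk_r_lt y z x _ cy cz cx (klein_disk p) yzx h.
    by rewrite orient_swap o0 oppr0 ltxx.
  - move=> _; rewrite leNgt; apply/negP => h.
    have := half_disk_l_lt y z x _ cy cz cx (klein_disk p) yzx h.
    by rewrite orient_swap o0 oppr0 ltxx.
split=> //; first exact: circle_disk; rewrite klein_circle// => _.
  case: hp => [->|->|xpy]; rewrite ?orientl//.
    by move: yzx => /ltW.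
  have := ccw_rebase x p y z cx cp cy cz xpy xyz; rewrite ccwE orientC => /ltW //.
case: hp => [->|->|xpy]; rewrite ?orientr//.
  by move: yzx; rewrite ccwE orientC => /ltW.
have := ccw_trans x p y z cx cp cy cz xpy xyz; rewrite ccwE.
by rewrite -orientC => /ltW.
Qed.

Lemma curve_rot_cover P Q S x y z : circle R x -> circle R y -> circle R z ->
  ccw x y z ->
  curve P x y `|` curve Q y z `|` curve S z x `<=` closed_tri P Q S x y z.
Proof.
move=> cx cy cz xyz p [[|]|].
- exact: curve_closed_tri.
- rewrite closed_tri_rot; apply: curve_closed_tri => //; exact: ccwC.
- rewrite -closed_tri_rot; apply: curve_closed_tri => //; exact/ccwC/ccwC.
Qed.

Lemma curve_endl P x y : circle R x -> circle R y -> x <> y -> curve P x y x.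
Proof.
move=> cx cy xy; have [hP|nP] := pselect P; [left|right]; split=> //.
  exact: geodesic_endl.
by split=> //; constructor 1.
Qed.

(** A circle point other than the vertices lies on one of the three arcs between them. If that side
    is a geodesic, its sign condition excludes the arc; otherwise the arc is part of the removed
    boundary. So only interior points remain, and off the geodesic sides the weak inequalities are
    strict. *)
Lemma closed_tri_diff P Q S x y z : circle R x -> circle R y -> circle R z ->
  ccw x y z ->
  closed_tri P Q S x y z `\` (curve P x y `|` curve Q y z `|` curve S z x)
    `<=` open_tri P Q S x y z.
Proof.
move=> cx cy cz xyz p [[dp h1 h2 h3] /not_orP[/not_orP[n1 n2] n3]].
have [xy yz xz] := ccw_neq _ _ _ xyz.
have edge_case P0 u v : ~ curve P0 u v p -> circle R u -> circle R v -> circle R p ->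
    (P0 -> 0 <= orient u v (klein p)) -> ~ ccw u p v.
  move=> nc cu cv cp h upv; apply: nc.
  have [hP|nP] := pselect P0; last by right; split=> //; split=> //; constructor 3.
  by move: (h hP) upv; rewrite klein_circle// ccwE orient_perm oppr_ge0 => /le_lt_trans h' /h'; rewrite ltxx.
have ip : dot p p < 1.
  case: (disk_circle_or_int _ dp) => // cp; exfalso.
  case: (arc_cases x y z p cx cy cz cp xyz) => [[e|[e|e]]|h|h|h]; rewrite ?e in n1 n2 n3.
  - by apply: n1; exact: curve_endl.
  - by apply: n2; exact: curve_endl.
  - by apply: n3; apply: curve_endl => //; exact: nesym.
  - exact: (edge_case P x y).
  - exact: (edge_case Q y z).
  - exact: (edge_case S z x).
have strict (P0 : Prop) u v : ~ curve P0 u v p -> circle R u -> circle R v -> u <> v ->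
    (P0 -> 0 <= orient u v (klein p)) -> P0 -> 0 < orient u v (klein p).
  move=> nc cu cv uv h hP; rewrite lt_neqAle h// andbT; apply/eqP => e; apply: nc.
  by left; split=> //; apply/geodesicP.
by split=> //; apply: strict => //; exact: nesym.
Qed.

Lemma continuous_fst2 : continuous (@fst R R).
Proof. by move=> p; exact: cvg_fst. Qed.

Lemma continuous_snd2 : continuous (@snd R R).
Proof. by move=> p; exact: cvg_snd. Qed.

Lemma continuous_dot (T : topologicalType) (f g : T -> R * R) :
  continuous f -> continuous g -> continuous (fun w => dot (f w) (g w)).
Proof.
move=> cf cg p; apply: cvgD; apply: cvgM.
- exact: (continuous_comp (cf p) (@continuous_fst2 _)).
- exact: (continuous_comp (cg p) (@continuous_fst2 _)).
- exact: (continuous_comp (cf p) (@continuous_snd2 _)).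
- exact: (continuous_comp (cg p) (@continuous_snd2 _)).
Qed.

Lemma continuous_pair (T : topologicalType) (f g : T -> R) :
  continuous f -> continuous g -> continuous (fun w => (f w, g w)).
Proof. by move=> cf cg p; apply: (@cvg_pair _ _ _ _ (nbhs (f p)) (nbhs (g p))); [exact: cf|exact: cg]. Qed.

Lemma continuous_klein : continuous (@klein R).
Proof.
have cd : continuous (fun p => (1 + dot p p)^-1 : R).
  move=> p; apply: cvgV; first exact/lt0r_neq0/dot1_gt0.
  by apply: cvgD; [exact: cvg_cst|apply: (continuous_dot _ id id) => ?; exact: cvg_id].
apply: continuous_pair => p; apply: cvgM; try exact: cd.
  by apply: cvgM; [exact: cvg_cst|exact: continuous_fst2].
by apply: cvgM; [exact: cvg_cst|exact: continuous_snd2].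
Qed.

Lemma continuous_orient x y : continuous (orient x y).
Proof.
move=> k; rewrite /orient /cross /=; apply: cvgB; apply: cvgM; try exact: cvg_cst.
  by apply: cvgB; [exact: continuous_snd2|exact: cvg_cst].
by apply: cvgB; [exact: continuous_fst2|exact: cvg_cst].
Qed.

Lemma continuous_orient_klein x y : continuous (fun p => orient x y (klein p)).
Proof.
by move=> p; apply: continuous_comp; [exact: continuous_klein|exact: continuous_orient].
Qed.

Lemma closed_disk : closed (disk R).
Proof.
apply: (@closed_comp _ _ (fun p => dot p p) [set r | r <= 1]); last exact: closed_le.
by move=> p _; apply: (continuous_dot _ id id) => ?; exact: cvg_id.
Qed.

Lemma closed_closed_tri P Q S x y z : closed (closed_tri P Q S x y z).
Proof.
have half P0 (u v : R * R) : closed [set p | P0 -> 0 <= orient u v (klein p)].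
  have [hP|nP] := pselect P0; last first.
    by rewrite (_ : [set _ | _] = setT) ?closedT//; apply/seteqP; split=> // p _ /nP.
  rewrite (_ : [set _ | _] = (fun p => orient u v (klein p)) @^-1` [set r | 0 <= r]); last first.
    by apply/seteqP; split=> p /=; [move=> /(_ hP)|move=> ? _].
  apply: closed_comp; last exact: closed_ge.
  by move=> p _; exact: continuous_orient_klein.
rewrite (_ : closed_tri _ _ _ _ _ _ = disk R `&` ([set p | P -> 0 <= orient x y (klein p)] `&`
   ([set p | Q -> 0 <= orient y z (klein p)] `&` [set p | S -> 0 <= orient z x (klein p)]))).
  by apply: closedI; [exact: closed_disk|apply: closedI; [exact: half|apply: closedI; exact: half]].
by apply/seteqP; split=> p; [move=> []|move=> [? [? []]]].
Qed.

Lemma open_open_tri P Q S x y z : open (open_tri P Q S x y z).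
Proof.
have half P0 (u v : R * R) : open [set p | P0 -> 0 < orient u v (klein p)].
  have [hP|nP] := pselect P0; last first.
    by rewrite (_ : [set _ | _] = setT); [exact: openT|apply/seteqP; split=> // p _ /nP].
  rewrite (_ : [set _ | _] = (fun p => orient u v (klein p)) @^-1` [set r | 0 < r]); last first.
    by apply/seteqP; split=> p /=; [move=> /(_ hP)|move=> ? _].
  apply: open_comp; last exact: open_gt.
  by move=> p _; exact: continuous_orient_klein.
rewrite (_ : open_tri _ _ _ _ _ _ = [set p | dot p p < 1] `&` ([set p | P -> 0 < orient x y (klein p)] `&`
   ([set p | Q -> 0 < orient y z (klein p)] `&` [set p | S -> 0 < orient z x (klein p)]))).
  apply: openI; last by apply: openI; [exact: half|apply: openI; exact: half].
  apply: (@open_comp _ _ (fun p => dot p p) [set r | r < 1]); last exact: open_lt.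
  by move=> p _; apply: (continuous_dot _ id id) => ?; exact: cvg_id.
by apply/seteqP; split=> p; [move=> []|move=> [? [? []]]].
Qed.

End Triangles.

(** * Computation of the region enclosed by the boundary of a triangle *)

Section Enclosed.
Context {R : realType}.
Implicit Types (x y z c d p q : R * R) (P Q S : Prop) (A J : set (R * R)).

Lemma bounded_setP (B : set (R * R)) :
  bounded_set B <-> exists M : R, forall q, B q -> `|q| <= M.
Proof.
split=> [[M [_ hM]]|[M hM]].
  by exists (M + 1) => q Bq; apply: (hM (M + 1)) => //; rewrite ltrDl.
exists M; split; first exact: num_real.
by move=> N MN q Bq; exact: le_trans (hM q Bq) (ltW MN).
Qed.

Lemma continuous_chord_point c d : continuous (chord_point c d).
Proof.
apply: continuous_pair => t; apply: cvgD; try exact: cvg_cst.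
  by apply: cvgM; [exact: cvg_id|exact: cvg_cst].
by apply: cvgM; [exact: cvg_id|exact: cvg_cst].
Qed.

Lemma chord_point0 c d : chord_point c d 0 = c.
Proof. by rewrite /chord_point !mul0r !addr0; case: c. Qed.

Lemma chord_point1 c d : chord_point c d 1 = d.
Proof. by rewrite /chord_point !mul1r !subrKC; case: d. Qed.

Lemma ray_unbounded A p q : p <> q ->
  (forall t : R, 0 <= t -> A (chord_point p q t)) ->
  ~ bounded_set (connected_component A p).
Proof.
move=> pq hA /bounded_setP[M hM].
have conn : connected (chord_point p q @` [set t | 0 <= t]).
  apply: connected_continuous_connected.
    apply/connected_intervalP => s t /= s0 t0 r /andP[sr _]; exact: le_trans sr.
  exact/continuous_subspaceT/continuous_chord_point.
have sub : chord_point p q @` [set t | 0 <= t] `<=` connected_component A p.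
  apply: connected_component_max conn; last by move=> _ [t /= t0 <-]; exact: hA.
  by exists 0; rewrite /= ?lexx ?chord_point0.
have bnd t : 0 <= t -> `|chord_point p q t| <= M.
  by move=> t0; apply: hM; apply: sub; exists t.
have coord (u v : R) : (forall t, 0 <= t -> `|u + t * v| <= M) -> v = 0.
  move=> h; apply/eqP/negPn/negP => v0.
  have v1 : 0 < `|v| by rewrite normr_gt0.
  have M0 : 0 <= M by apply: le_trans (h 0 _); rewrite ?normr_ge0.
  have t0 : 0 <= (M + 1 + `|u|) / `|v| by rewrite divr_ge0 ?addr_ge0.
  have := ler_normB (u + (M + 1 + `|u|) / `|v| * v) u; have := h _ t0.
  rewrite [u + _ - u]addrAC subrr add0r normrM (ger0_norm t0) divfK ?gt_eqF//.
  by move: (normr_ge0 u); lra.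
apply: pq; apply: pair_dist0.
have e1 : q.1 - p.1 = 0.
  by apply: (coord p.1) => t t0; apply: le_trans (bnd t t0); rewrite [leRHS]/Num.norm/= le_max lexx.
have e2 : q.2 - p.2 = 0.
  by apply: (coord p.2) => t t0; apply: le_trans (bnd t t0); rewrite [leRHS]/Num.norm/= le_max lexx orbT.
by rewrite -opprB e1 -(opprB q.2) e2 oppr0 expr0n addr0.
Qed.

Lemma segment_component A p q :
  (forall t : R, 0 <= t <= 1 -> A (chord_point p q t)) ->
  connected_component A p = connected_component A q.
Proof.
move=> hA; apply: same_connected_component.
have conn : connected (chord_point p q @` `[0, 1]).
  apply: connected_continuous_connected; first exact: segment_connected.
  exact/continuous_subspaceT/continuous_chord_point.
apply: (connected_component_max _ _ conn).
- by exists 0; rewrite /= ?in_itv/= ?lexx ?ler01 ?chord_point0.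
- by move=> q' [r hr <-]; apply: hA; move: hr; rewrite /= in_itv.
- by exists 1; rewrite /= ?in_itv/= ?lexx ?ler01 ?chord_point1.
Qed.

Lemma outside_unbounded A p : (forall q, 1 < dot q q -> A q) -> 1 < dot p p ->
  ~ bounded_set (connected_component A p).
Proof.
move=> hA p1; apply: (@ray_unbounded _ _ (2 * p.1, 2 * p.2)).
  move=> e; have /= e1 := congr1 fst e; have /= e2 := congr1 snd e; clear e.
  have a0 : p.1 = 0 by lra.
  have b0 : p.2 = 0 by lra.
  by move: p1; rewrite /dot a0 b0; lra.
move=> t t0; apply: hA; apply: lt_le_trans p1 _.
have -> : dot (chord_point p (2 * p.1, 2 * p.2) t) (chord_point p (2 * p.1, 2 * p.2) t) = (1 + t) ^+ 2 * dot p p.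
  by rewrite /dot /chord_point /=; ring.
by rewrite ler_peMl ?dot_ge0// expr_ge1//; lra.
Qed.

(** If [0 < cross x y], the set [side x y q < 0] is a Euclidean disk around the pole of the chord,
    and the pole is outside the unit disk: a segment to the pole followed by a radial ray escapes.
    Otherwise [side x y] is concave along lines, and a ray that starts in a direction of nonpositive
    slope stays in the negative region. *)
Lemma side_unbounded A x y p : circle R x -> circle R y -> x <> y ->
  (forall q, 1 < dot q q -> A q) -> (forall q, side x y q < 0 -> A q) ->
  side x y p < 0 -> ~ bounded_set (connected_component A p).
Proof.
move=> cx cy xy hA hS p0.
have [s0|s0] := ltP 0 (cross x y).
  pose c : R * R := ((y.2 - x.2) / cross x y, - (y.1 - x.1) / cross x y).
  have sn := lt0r_neq0 s0.
  rewrite (@segment_component _ p c).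
    apply: outside_unbounded => //.
    have lxy : 0 < lam x y by apply: lam_gt0 => //; exact: circle_disk.
    have -> : dot c c = 2 * lam x y / cross x y ^+ 2.
      move: (circleE _ cx) (circleE _ cy) => ex ey.
      rewrite /dot /c /=.
      have -> : 2 * lam x y = (y.2 - x.2)^+2 + (y.1 - x.1)^+2.
        by rewrite /lam /dot; ring: ex ey.
      by field.
    rewrite ltr_pdivlMr ?exprn_even_gt0//= mul1r.
    have -> : cross x y ^+ 2 = 2 * lam x y - lam x y ^+ 2.
      move: (circleE _ cx) (circleE _ cy) => ex ey.
      by rewrite /lam /dot /cross; ring: ex ey.
    by rewrite gtrBl exprn_gt0.
  move=> t /andP[t0 t1]; apply: hS.
  have -> : side x y (chord_point p c t) =
      side x y p - cross x y * dot (c - p) (c - p) * (t * (2 - t)).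
    rewrite /side /c /chord_point /dot /cross /=; field; exact: sn.
  apply: le_lt_trans p0; rewrite gerBl mulr_ge0//.
    by rewrite mulr_ge0 ?dot_ge0// ltW.
  by rewrite mulr_ge0//; lra.
(* Half the gradient of [side x y] at [p]. The ray follows its opposite, or an arbitrary direction
   if it vanishes. *)
pose w : R * R := (- (y.2 - x.2) + cross x y * p.1, y.1 - x.1 + cross x y * p.2).
have expand q t : side x y (chord_point p q t) =
    side x y p + 2 * t * dot w (q - p) + t ^+ 2 * dot (q - p) (q - p) * cross x y.
  by rewrite /side /w /chord_point /dot /cross /=; ring.
have ray q : dot w (q - p) <= 0 -> p <> q -> ~ bounded_set (connected_component A p).
  move=> wq pq; apply: (@ray_unbounded _ _ q) => // t t0; apply: hS; rewrite expand.
  have h1 : 2 * t * dot w (q - p) <= 0 by rewrite mulr_ge0_le0// mulr_ge0.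
  have h2 : t ^+ 2 * dot (q - p) (q - p) * cross x y <= 0.
    by rewrite mulr_ge0_le0// mulr_ge0 ?sqr_ge0 ?dot_ge0.
  lra.
have [w0|wn0] := pselect (dot w w = 0).
  have [w1 w2] : w.1 = 0 /\ w.2 = 0.
    have : (w.1 - 0) ^+ 2 + (w.2 - 0) ^+ 2 = 0 by rewrite !subr0 !expr2.
    by move/(@pair_dist0 _ w (0, 0)) => ->.
  apply: (ray (p.1 + 1, p.2)); first by rewrite /dot w1 w2; lra.
  by move=> e; have /= := congr1 fst e; clear e; lra.
apply: (ray (p.1 - w.1, p.2 - w.2)).
  have -> : dot w ((p.1 - w.1, p.2 - w.2) - p) = - dot w w by rewrite /dot /=; ring.
  by rewrite oppr_le0 dot_ge0.
move=> e; apply: wn0; have [e1 e2] : w.1 = 0 /\ w.2 = 0.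
  by have /= e1 := congr1 fst e; have /= e2 := congr1 snd e; clear e; split; lra.
by rewrite /dot e1 e2; lra.
Qed.

Lemma bounded_disk : bounded_set (disk R).
Proof.
apply/bounded_setP; exists 1 => p /= dp.
rewrite [leLHS]/Num.norm/= ge_max.
have := sqr_ge0 p.1; have := sqr_ge0 p.2; move: dp; rewrite /disk /dot/= => dp h1 h2.
by rewrite -2![`|_| <= 1](ler_sqr (normr_ge0 _) ler01) !real_normK ?num_real// expr1n; nra.
Qed.

Lemma open_closed_tri P Q S x y z : open_tri P Q S x y z `<=` closed_tri P Q S x y z.
Proof.
move=> p [h1 h2 h3 h4]; split; [exact: ltW|..]; by move=> h; apply: ltW; auto.
Qed.

(** A point violating a condition of [closed_tri] reaches infinity without meeting the boundary [J].
    Conversely [closed_tri] and [open_tri] agree off [J], so the component of a point of the region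
    is trapped inside the disk. *)
Lemma enclosed_triangle P Q S x y z : circle R x -> circle R y -> circle R z ->
  ccw x y z ->
  enclosed (curve P x y `|` curve Q y z `|` curve S z x) = closed_tri P Q S x y z.
Proof.
move=> cx cy cz xyz; set J := _ `|` _.
have [xy yz xz] := ccw_neq _ _ _ xyz.
have JT : J `<=` closed_tri P Q S x y z by exact: curve_rot_cover.
have TO : closed_tri P Q S x y z `\` J `<=` open_tri P Q S x y z by exact: closed_tri_diff.
have Jout q : 1 < dot q q -> (~` J) q.
  by move=> q1 /JT[]; rewrite /disk/= leNgt q1.
apply/seteqP; split=> p.
  case=> [/JT//|[nJ bC]]; apply: contrapT => nT.
  have edge (P0 : Prop) u v : circle R u -> circle R v -> u <> v -> P0 ->
      (forall q, closed_tri P Q S x y z q -> P0 -> 0 <= orient u v (klein q)) ->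
      0 <= orient u v (klein p).
    move=> cu cv uv hP hT; rewrite leNgt; apply/negP => o0.
    have : side u v p < 0 by rewrite sideE pmulr_rlt0 ?dot1_gt0.
    move/(side_unbounded (~` J) u v p cu cv uv Jout); apply=> // q.
    rewrite sideE pmulr_rlt0 ?dot1_gt0// => o0' /JT/hT/(_ hP).
    by rewrite leNgt o0'.
  apply: nT; split.
  - rewrite /disk/= leNgt; apply/negP => p1; exact: (outside_unbounded (~` J) p).
  - by move=> hP; apply: (edge P) => // q [].
  - by move=> hP; apply: (edge Q) => // q [].
  - by move=> hP; apply: (edge S) => //; [exact: nesym|move=> q []].
move=> pT; have [Jp|nJ] := pselect (J p); [by left|right; split=> //].
have CJ := @connected_component_sub _ (~` J) p.
(* the interior of the triangle is clopen in the complement of [J] *)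
have CT : connected_component (~` J) p `&` open_tri P Q S x y z =
    connected_component (~` J) p.
  apply: (@component_connected _ (~` J) p).
  - exists p; split; first exact: connected_component_refl.
    exact: TO.
  - by exists (open_tri P Q S x y z) => //; exact: open_open_tri.
  - exists (closed_tri P Q S x y z); first exact: closed_closed_tri.
    apply/seteqP; split=> q [Cq].
      by move=> /open_closed_tri.
    by move=> Tq; split=> //; apply: TO; split=> //; exact: CJ.
move/bounded_setP: bounded_disk => [M hM]; apply/bounded_setP; exists M => q Cq; apply: hM.
by move: Cq; rewrite -CT => -[_ [/ltW]].
Qed.

End Enclosed.

(** * Existence of successors and predecessors *)

Section Successors.
Context {R : realType}.
Implicit Types (z w p a b : R * R) (Z : set (R * R)) (m : R).

(* Cotangent of half the angle from [w] to [z]: it maps the circle minus [z]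
   increasingly onto the real line. *)
Definition slope z w : R := - cross z w / lam w z.

(* Inverse of [slope z]: the second intersection with the circle of the line
   through [z] of slope [m] with respect to the normal at [z]. *)
Definition unslope z m : R * R :=
  (z.1 + 2 / (1 + m ^+ 2) * (- z.1 + m * z.2),
   z.2 + 2 / (1 + m ^+ 2) * (- z.2 - m * z.1)).

Lemma sqr1_gt0 m : 0 < 1 + m ^+ 2.
Proof. by rewrite ltr_wpDr ?sqr_ge0. Qed.

Lemma lam_circle_gt0 z w : circle R z -> circle R w -> w <> z -> 0 < lam w z.
Proof. by move=> cz cw; apply: lam_gt0 => //; exact: circle_disk. Qed.

Lemma orient_slope z a b : circle R z -> lam a z != 0 -> lam b z != 0 ->
  orient z a b = lam a z * lam b z * (slope z b - slope z a).
Proof.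
move=> cz la lb; have -> : lam a z * lam b z * (slope z b - slope z a) =
  lam b z * cross z a - lam a z * cross z b by rewrite /slope; field; rewrite la lb.
by move: (circleE _ cz) => hz; rewrite /orient /lam /cross /dot /=; ring: hz.
Qed.

Lemma ccw_slope z a b : circle R z -> circle R a -> circle R b ->
  a <> z -> b <> z -> ccw z a b <-> slope z a < slope z b.
Proof.
move=> cz ca cb az bz.
have la := lam_circle_gt0 _ _ cz ca az; have lb := lam_circle_gt0 _ _ cz cb bz.
by rewrite ccwE orient_slope ?lt0r_neq0// pmulr_rgt0 ?mulr_gt0// subr_gt0.
Qed.

Lemma circle_unslope z m : circle R z -> circle R (unslope z m).
Proof.
move=> cz; move: (circleE _ cz) => hz; have m0 := lt0r_neq0 (sqr1_gt0 m).
by rewrite /circle /unslope /dot /=; field: hz.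
Qed.

Lemma lam_unslope z m : circle R z -> lam (unslope z m) z = 2 / (1 + m ^+ 2).
Proof.
move=> cz; move: (circleE _ cz) => hz; have m0 := lt0r_neq0 (sqr1_gt0 m).
by rewrite /lam /unslope /dot /=; field: hz.
Qed.

Lemma slope_unslope z m : circle R z -> slope z (unslope z m) = m.
Proof.
move=> cz; rewrite /slope lam_unslope//; move: (circleE _ cz) => hz.
have m0 := lt0r_neq0 (sqr1_gt0 m).
by rewrite /unslope /cross /=; field: hz.
Qed.

Lemma unslope_slope z w : circle R z -> circle R w -> w <> z ->
  unslope z (slope z w) = w.
Proof.
move=> cz cw wz; have /lt0r_neq0 l0 := lam_circle_gt0 _ _ cz cw wz.
have e : 2 / (1 + slope z w ^+ 2) = lam w z.
  have h : lam w z ^+ 2 + cross z w ^+ 2 = 2 * lam w z.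
    move: (circleE _ cz) (circleE _ cw) => hz hw.
    by rewrite /lam /cross /dot; ring: hz hw.
  have -> : 1 + slope z w ^+ 2 = 2 / lam w z.
    have -> : 1 + slope z w ^+ 2 = (lam w z ^+ 2 + cross z w ^+ 2) / lam w z ^+ 2.
      by rewrite /slope; field.
    by rewrite h; field.
  by field.
rewrite /unslope e /slope.
have -> : lam w z * (- z.1 + - cross z w / lam w z * z.2) =
  - z.1 * lam w z - cross z w * z.2 by field.
have -> : lam w z * (- z.2 - - cross z w / lam w z * z.1) =
  - z.2 * lam w z + cross z w * z.1 by field.
move: (circleE _ cz) => hz; case: w {wz l0 e cw} => w1 w2.
by rewrite /lam /cross /dot /=; congr pair; ring: hz.
Qed.

(** The two sides of a point in [admissible] are given by the sign of [cross]. Near [unslope z m]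
    all factors other than [slope z w - m] are positive, so these sides become the values of the
    slope above and below [m]. *)
Lemma cross_unslope z m w : circle R z -> circle R w -> w <> z ->
  cross (unslope z m) w =
  (lam w z * (slope z w - m)) * (lam w z - m * cross z w) * ((1 + m ^+ 2)^-1 / lam w z).
Proof.
move=> cz cw wz; have /lt0r_neq0 l0 := lam_circle_gt0 _ _ cz cw wz.
have m0 := lt0r_neq0 (sqr1_gt0 m).
have -> : lam w z * (slope z w - m) = - cross z w - m * lam w z by rewrite /slope; field.
have h : cross z w ^+ 2 = 2 * lam w z - lam w z ^+ 2.
  move: (circleE _ cz) (circleE _ cw) => hz hw.
  by rewrite /lam /cross /dot; ring: hz hw.
have -> : (- cross z w - m * lam w z) * (lam w z - m * cross z w) =
   lam w z * (- cross z w * (1 + m ^+ 2) + m ^+ 2 * cross z w + 2 * m + (m ^+ 2 * cross z w) - 2 * m * lam w z).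
  have -> : (- cross z w - m * lam w z) * (lam w z - m * cross z w) =
    m * cross z w ^+ 2 - cross z w * lam w z + m ^+ 2 * cross z w * lam w z - m * lam w z ^+ 2 by ring.
  by rewrite h; ring.
move: (circleE _ cz) => hz.
have -> : lam w z * (- cross z w * (1 + m ^+ 2) + m ^+ 2 * cross z w + 2 * m + m ^+ 2 * cross z w - 2 * m * lam w z) *
  ((1 + m ^+ 2)^-1 / lam w z) = (- cross z w + m ^+ 2 * cross z w + 2 * m - 2 * m * lam w z) / (1 + m ^+ 2).
  by field; rewrite m0 l0.
rewrite /unslope /cross /lam /dot /=.
by field.
Qed.

Lemma continuous_unslope z : continuous (unslope z).
Proof.
have ci : continuous (fun m : R => 2 / (1 + m ^+ 2)).
  move=> m; apply: cvgM; first exact: cvg_cst.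
  apply: cvgV; first exact/lt0r_neq0/sqr1_gt0.
  apply: cvgD; first exact: cvg_cst.
  by rewrite expr2; under eq_fun do rewrite expr2; apply: cvgM; exact: cvg_id.
apply: continuous_pair => m; apply: cvgD; try exact: cvg_cst.
  apply: cvgM; first exact: ci.
  apply: cvgD; first exact: cvg_cst.
  by apply: cvgM; [exact: cvg_id|exact: cvg_cst].
apply: cvgM; first exact: ci.
apply: cvgB; first exact: cvg_cst.
by apply: cvgM; [exact: cvg_id|exact: cvg_cst].
Qed.

Lemma continuous_lam z : continuous (lam^~ z).
Proof.
move=> w; apply: cvgB; first exact: cvg_cst.
by apply: (continuous_dot _ id (cst z)) => p; [exact: cvg_id|exact: cvg_cst].
Qed.

Lemma continuous_cross z : continuous (cross z).
Proof.
move=> w; apply: cvgB.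
  by apply: cvgM; [exact: cvg_cst|exact: continuous_snd2].
by apply: cvgM; [exact: cvg_cst|exact: continuous_fst2].
Qed.

(** Pigeonhole: three distinct elements of [Z] cannot all be equal to [x] or [y]. *)
Lemma admissible_other Z : admissible Z -> forall x y, exists2 w, Z w & w <> x /\ w <> y.
Proof.
move=> [_ _ _ /card_leP[f]] x y; apply: contrapT => h.
pose g i (i4 : (i < 4)%N) := f (exist _ i (mem_set (i4 : `I_4 i))).
have hxy i i4 : \val (g i i4) = x \/ \val (g i i4) = y.
  apply: contrapT => /not_orP[fx fy]; apply: h; exists (\val (g i i4)) => //.
  exact: set_valP.
have inj i j i4 j4 : \val (g i i4) = \val (g j j4) -> i = j.
  by move=> /val_inj/(@inj _ _ _ f) -/(_ (mem_set I) (mem_set I))/(congr1 val).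
have := hxy 0%N isT; have := hxy 1%N isT; have := hxy 2%N isT.
have n01 : \val (g 0%N isT) <> \val (g 1%N isT) by move=> /inj.
have n02 : \val (g 0%N isT) <> \val (g 2%N isT) by move=> /inj.
have n12 : \val (g 1%N isT) <> \val (g 2%N isT) by move=> /inj.
by move=> [] e2 [] e1 [] e0; move: n01 n02 n12; rewrite e0 e1 e2.
Qed.

(** The slope blows up only near [z], and the isolation of [z] keeps the rest of [Z] away from
    it. *)
Lemma slope_bounded Z z : admissible Z -> Z z -> exists B,
  forall w, Z w -> w <> z -> `|slope z w| <= B.
Proof.
move=> [Zc Zi _ _] Zz; have cz := Zc _ Zz.
have [_ [V /nbhs_ballP[e /= e0 eV] VZ]] := Zi _ Zz.
exists (2 / e ^+ 2) => w Zw wz; have cw := Zc _ Zw.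
have l0 := lam_circle_gt0 _ _ cz cw wz.
(* [2 * lam w z] is the squared distance from [w] to [z]. If it were less than [e ^+ 2], both
   coordinates would differ by less than [e], and the isolating neighbourhood would force
   [w = z]. *)
have far : e ^+ 2 / 2 <= lam w z.
  rewrite leNgt; apply/negP => lt; apply: wz; rewrite -[_ = _]/([set z] w) -VZ; split=> //.
  apply: eV; move: (circleE _ cz) (circleE _ cw) lt => hz hw.
  rewrite /lam /dot => lt.
  have := sqr_ge0 (z.1 - w.1); have := sqr_ge0 (z.2 - w.2) => s2 s1.
  by split; rewrite /ball/= -(ltr_sqr (normr_ge0 _) (ltW e0)) real_normK ?num_real//;
    move: s1 s2; rewrite !sqrrB !expr2 !mulr2n; lra.
have c1 : `|cross z w| <= 1.
  rewrite -(ler_sqr (normr_ge0 _) ler01) real_normK ?num_real// expr1n.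
  have -> : cross z w ^+ 2 = 1 - dot z w ^+ 2.
    move: (circleE _ cz) (circleE _ cw) => hz hw.
    by rewrite /cross /dot; ring: hz hw.
  by rewrite gerBl sqr_ge0.
rewrite /slope normrM normrN normfV (gtr0_norm l0).
apply: (@le_trans _ _ (1 / lam w z)); first by rewrite ler_pM2r ?invr_gt0.
have e2 : 0 < e ^+ 2 by rewrite exprn_gt0.
rewrite ler_pdivrMr// -ler_pdivrMl ?divr_gt0//.
by rewrite mulr1 invf_div.
Qed.

(* The two-sided limit condition on [Z], read on the real line. *)
Lemma slope_accumulation Z z m : admissible Z -> Z z ->
  (forall w, Z w -> w <> z -> slope z w <> m) ->
  (forall e, 0 < e -> exists w, [/\ Z w, w <> z & `|m - slope z w| < e]) ->
  (exists w, [/\ Z w, w <> z & slope z w < m]) /\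
  (exists w, [/\ Z w, w <> z & m < slope z w]).
Proof.
move=> [Zc _ Zl _] Zz mZ acc; have cz := Zc _ Zz.
have cp := circle_unslope z m cz.
have lim : limit_point Z (unslope z m).
  move=> U /(continuous_unslope z m)/nbhs_ballP[e /= e0 eU].
  have [w [Zw wz we]] := acc e e0; exists w; have cw := Zc _ Zw; split=> //.
    by apply/eqP => e'; apply: (mZ w Zw wz); rewrite e' slope_unslope.
  by rewrite -(unslope_slope z w)//; exact: eU.
have [l1 l2] := Zl _ cp lim.
(* On [U] the factors of [cross_unslope] other than [slope z w - m] are positive; the first
   condition also excludes [z] itself. *)
pose U := [set w | 0 < lam w z] `&` [set w | 0 < lam w z - m * cross z w].
have nU : nbhs (unslope z m) U.
  apply: open_nbhs_nbhs; split.
    apply: openI.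
      apply: (@open_comp _ _ (fun w => lam w z) [set r | 0 < r]); last exact: open_gt.
      by move=> w _; exact: continuous_lam.
    apply: (@open_comp _ _ (fun w => lam w z - m * cross z w) [set r | 0 < r]); last exact: open_gt.
    move=> w _; apply: cvgB; first exact: continuous_lam.
    by apply: cvgM; [exact: cvg_cst|exact: continuous_cross].
  have ml := lam_unslope z m cz; have ms := slope_unslope z m cz.
  have l0 : 0 < lam (unslope z m) z by rewrite ml divr_gt0// sqr1_gt0.
  split=> //=; have -> : cross z (unslope z m) = - (m * lam (unslope z m) z).
    by rewrite -{2}ms /slope; field; rewrite lt0r_neq0.
  have -> : lam (unslope z m) z - m * - (m * lam (unslope z m) z) = lam (unslope z m) z * (1 + m ^+ 2) by ring.
  by rewrite mulr_gt0// sqr1_gt0.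
have sgn w : Z w -> U w -> w <> z /\
    exists2 c, 0 < c & cross (unslope z m) w = c * (slope z w - m).
  move=> Zw [/= lw uw]; have cw := Zc _ Zw.
  have wz : w <> z by move=> e; move: lw; rewrite e /lam cz subrr ltxx.
  split=> //; exists (lam w z * (lam w z - m * cross z w) * ((1 + m ^+ 2)^-1 / lam w z)).
    by rewrite !mulr_gt0// ?invr_gt0// ?sqr1_gt0.
  by rewrite cross_unslope//; ring.
have [w1 [_ [Zw1 /= h1] Uw1]] := l1 _ nU; have [w2 [_ [Zw2 /= h2] Uw2]] := l2 _ nU.
split.
  exists w2; have [wz [c c0 e]] := sgn _ Zw2 Uw2; split=> //.
  by move: h2; rewrite e pmulr_rlt0// subr_lt0.
exists w1; have [wz [c c0 e]] := sgn _ Zw1 Uw1; split=> //.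
by move: h1; rewrite e pmulr_rgt0// subr_gt0.
Qed.

(** If the infimum of the slopes were not attained, it would be an accumulation value, and the
    two-sided limit condition would yield an element of still smaller slope. *)
Lemma slope_min Z z : admissible Z -> Z z -> exists y, [/\ Z y, y <> z &
  forall w, Z w -> w <> z -> slope z y <= slope z w].
Proof.
move=> aZ Zz; have [B hB] := slope_bounded Z z aZ Zz.
pose M := [set m | exists w, [/\ Z w, w <> z & m = slope z w]].
have Mlb : lbound M (- B) by move=> _ [w [Zw wz ->]]; have := hB _ Zw wz; rewrite ler_norml => /andP[].
have [w0 Zw0 [w0z _]] := admissible_other Z aZ z z.
have Minf : has_inf M by split; [exists (slope z w0); exists w0|exists (- B)].
have [[w [Zw wz ei]]|nM] := pselect (M (inf M)).
  exists w; split=> // v Zv vz; rewrite -ei; apply: (ge_inf Minf.2); by exists v.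
have [] := slope_accumulation Z z (inf M) aZ Zz.
- by move=> w Zw wz e; apply: nM; exists w.
- move=> e e0; have [_ [w [Zw wz ->]] lt] := inf_adherent e0 Minf.
  exists w; split=> //; have le : inf M <= slope z w by apply: (ge_inf Minf.2); exists w.
  by rewrite distrC ger0_norm ?subr_ge0// ltrBlDl.
- move=> [w [Zw wz lt]] _; have : inf M <= slope z w by apply: (ge_inf Minf.2); exists w.
  by rewrite leNgt lt.
Qed.

Lemma slope_max Z z : admissible Z -> Z z -> exists y, [/\ Z y, y <> z &
  forall w, Z w -> w <> z -> slope z w <= slope z y].
Proof.
move=> aZ Zz; have [B hB] := slope_bounded Z z aZ Zz.
pose M := [set m | exists w, [/\ Z w, w <> z & m = slope z w]].
have Mub : ubound M B by move=> _ [w [Zw wz ->]]; have := hB _ Zw wz; rewrite ler_norml => /andP[].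
have [w0 Zw0 [w0z _]] := admissible_other Z aZ z z.
have Msup : has_sup M by split; [exists (slope z w0); exists w0|exists B].
have [[w [Zw wz ei]]|nM] := pselect (M (sup M)).
  exists w; split=> // v Zv vz; rewrite -ei; apply: (ub_le_sup Msup.2); by exists v.
have [] := slope_accumulation Z z (sup M) aZ Zz.
- by move=> w Zw wz e; apply: nM; exists w.
- move=> e e0; have [_ [w [Zw wz ->]] lt] := sup_adherent e0 Msup.
  exists w; split=> //; have le : slope z w <= sup M by apply: (ub_le_sup Msup.2); exists w.
  by rewrite ger0_norm ?subr_ge0//; move: lt; lra.
- move=> _ [w [Zw wz lt]]; have : slope z w <= sup M by apply: (ub_le_sup Msup.2); exists w.
  by rewrite leNgt lt.
Qed.

(** From [z], counterclockwise order is increasing slope, so an element of least slope is the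
    successor. *)
Lemma succ_exists Z (z : Z) : admissible Z -> exists y : Z, succ z y.
Proof.
move=> aZ; have [Zc _ _ _] := aZ; have Zz := set_valP z.
have [y [Zy yz ymin]] := slope_min Z (\val z) aZ Zz.
exists (exist _ y (mem_set Zy)); split; first by move=> e; apply: yz; rewrite e.
move=> w zwy; have Zw := set_valP w.
have [/nesym wz _ _] := ccw_neq _ _ _ zwy.
have := ymin _ Zw wz; rewrite leNgt => /negP; apply.
by apply/ccw_slope => //; exact: Zc.
Qed.

Lemma pred_exists Z (z : Z) : admissible Z -> exists y : Z, succ y z.
Proof.
move=> aZ; have [Zc _ _ _] := aZ; have Zz := set_valP z.
have [y [Zy yz ymax]] := slope_max Z (\val z) aZ Zz.
exists (exist _ y (mem_set Zy)); split; first by move=> e; apply: yz; rewrite -e.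
move=> w /ccwC/ccwC zyw; have Zw := set_valP w.
have [_ _ /nesym wz] := ccw_neq _ _ _ zyw.
have := ymax _ Zw wz; rewrite leNgt => /negP; apply.
by apply/ccw_slope => //; exact: Zc.
Qed.

End Successors.

(** * Combinatorics of a cluster *)

Section CategoryFacts.
Context {k : fieldType} {C : shiftCategory k}.
Implicit Types X Y W : C.

Lemma linear_eq0 (U V : lmodType k) (f : U -> V) : linear f -> f 0 = 0.
Proof.
move=> lf; have := lf 1 0 0; rewrite !scale1r addr0 => e.
by apply: (addrI (f 0)); rewrite addr0 -e.
Qed.

Lemma isomorphic_refl X : isomorphic X X.
Proof. by exists (idm X), (idm X); rewrite comp_id_l. Qed.

Lemma isomorphic_sym X Y : isomorphic X Y -> isomorphic Y X.
Proof. by move=> [f [g [e1 e2]]]; exists g, f. Qed.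

Lemma isomorphic_trans X Y W : isomorphic X Y -> isomorphic Y W -> isomorphic X W.
Proof.
move=> [f [g [e1 e2]]] [f' [g' [e1' e2']]]; exists (Defs.comp f' f), (Defs.comp g g'); split.
  by rewrite -comp_assoc (comp_assoc g') e1' comp_id_l.
by rewrite -comp_assoc (comp_assoc f) e2 comp_id_l.
Qed.

Lemma Ext1_iso_eq0 X Y X' Y' : isomorphic X X' -> isomorphic Y Y' ->
  (forall e : Ext1 X Y, e = 0) -> forall e : Ext1 X' Y', e = 0.
Proof.
move=> [f [g [_ fg]]] [u [v [_ uv]]] h e.
have -> : e = Defs.comp (shift_hom u) (Defs.comp (Defs.comp (Defs.comp (shift_hom v) e) f) g).
  rewrite -!comp_assoc fg comp_id_r comp_assoc -shift_comp uv shift_id comp_id_l //.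
rewrite (h (Defs.comp (Defs.comp (shift_hom v) e) f)).
have -> := linear_eq0 _ _ _ (@comp_linear_l _ C _ _ (Defs.shift Y) g).
exact: (linear_eq0 _ _ _ (comp_linear_r _)).
Qed.

Lemma compatible_iso X Y X' Y' : isomorphic X X' -> isomorphic Y Y' ->
  compatible X Y -> compatible X' Y'.
Proof. by move=> iX iY [h1 h2]; split; [exact: Ext1_iso_eq0 h1|exact: Ext1_iso_eq0 h2]. Qed.

Lemma compatibleC X Y : compatible X Y -> compatible Y X.
Proof. by case. Qed.

End CategoryFacts.

Section HalfDiskInclusion.
Context {R : realType}.
Variables (x a b y k : R * R).
Hypotheses (cx : circle R x) (ca : circle R a) (cb : circle R b) (cy : circle R y).
Hypotheses (hk : dot k k <= 1) (xab : x = a \/ ccw x a b) (xby : b = y \/ ccw x b y).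

(** The points come in the order [x], [a], [b], [y], with coincidences allowed at both ends; the
    comparison passes through the chord [xb]. *)
Lemma half_disk_le : orient a b k <= 0 -> orient x y k <= 0.
Proof.
move=> h; have {}h : orient x b k <= 0.
  by case: xab => [->//|xab']; exact: (half_disk_l_le x a b).
by case: xby => [<-//|xby']; exact: (half_disk_r_le x b y).
Qed.

Lemma half_disk_lt : orient a b k < 0 -> orient x y k < 0.
Proof.
move=> h; have {}h : orient x b k < 0.
  by case: xab => [->//|xab']; exact: (half_disk_l_lt x a b).
by case: xby => [<-//|xby']; exact: (half_disk_r_lt x b y).
Qed.

End HalfDiskInclusion.

(** * Non-crossing edges and disjointness of the open cells *)

Section Cluster.
Context {R : realType} {k : fieldType} {Z : set (R * R)}.
Context (C : canonicalCategory k Z) (S : set C).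
Hypotheses (aZ : admissible Z) (clS : is_cluster S).
Implicit Types (x y z a b c d u v w : Z) (p q : R * R).

Notation inS := (in_up_to_iso S).
Notation edgeS := (edge S).

Lemma circleZ x : circle R (\val x).
Proof. by have [Zc _ _ _] := aZ; exact/Zc/set_valP. Qed.

Lemma val_neq x y : x <> y -> \val x <> \val y.
Proof. by move=> xy /val_inj. Qed.

Lemma geodesics_crossC (x y a b : R * R) :
  geodesics_cross x y a b -> geodesics_cross a b x y.
Proof. by move=> [ne [p [h1 h2 h3]]]; split; [exact: nesym|exists p]. Qed.

Lemma diagonalC x y : Defs.diagonal x y -> Defs.diagonal y x.
Proof. by move=> [h1 h2 h3]; split=> // e; exact/h1/esym. Qed.

Lemma in_diagonal x y : inS x y -> Defs.diagonal x y.
Proof. by case. Qed.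

Lemma in_neq x y : inS x y -> x <> y.
Proof. by move=> /in_diagonal[] /nesym. Qed.

Lemma inC x y : inS x y -> inS y x.
Proof.
move=> [d [X SX iX]]; split; first exact: diagonalC.
exists X => //; apply: (isomorphic_trans _ _ _ iX); apply/isomorphic_E => //.
  exact: diagonalC.
by right.
Qed.

Lemma edgeC x y : edgeS x y -> edgeS y x.
Proof. by case=> h; [constructor 1; exact: inC|constructor 3|constructor 2]. Qed.

Lemma edge_neq x y : edgeS x y -> x <> y.
Proof. by case=> [/in_neq|[]|[] /nesym]. Qed.

(** Both pairs may name the same object of [S], about which the cluster says nothing. Then
    [isomorphic_E] makes the pairs agree up to order, and equal geodesics do not cross by
    definition. *)
Lemma in_noncross x y a b : inS x y -> inS a b ->
  ~ geodesics_cross (\val x) (\val y) (\val a) (\val b).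
Proof.
move=> [dxy [X SX iX]] [dab [Y SY iY]].
have [[_ famS] _] := clS.
have [eXY|nXY] := pselect (X = Y).
  have : isomorphic (E C x y) (E C a b).
    by apply: (isomorphic_trans _ _ _ (isomorphic_sym _ _ iX)); rewrite eXY.
  move=> /isomorphic_E -/(_ dxy dab)[[-> ->] [] //|[ex ey]] [] ne _; apply: ne.
  rewrite ex ey; apply: geodesicC; try exact: circleZ.
  by apply: val_neq => e; case: dab => /(_ (esym (esym e))); rewrite e.
have [cXY _] := famS _ _ SX SY nXY.
by apply/compatible_E => //; exact: compatible_iso iX iY cXY.
Qed.

(** Each member of [S] is isomorphic to some [E C c d], and compatibility is invariant under
    isomorphism. So if [E C a b] were not already represented, adjoining it would contradict the
    maximality of [S]. *)
Lemma in_maximal a b : Defs.diagonal a b ->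
  (forall c d, inS c d -> ~ geodesics_cross (\val a) (\val b) (\val c) (\val d)) ->
  inS a b.
Proof.
move=> dab nc; have [[indS famS] maxS] := clS; apply: contrapT => nin.
have niso X : S X -> ~ isomorphic X (E C a b) by move=> SX iX; apply: nin; split=> //; exists X.
have cpt X : S X -> compatible X (E C a b).
  move=> SX; have /indecomposableP[c [d [dcd iX]]] := indS _ SX.
  apply: (compatible_iso _ _ _ _ (isomorphic_sym _ _ iX) (isomorphic_refl _)).
  apply/compatible_E => // /geodesics_crossC; apply: nc; split=> //.
  by exists X.
have eT : S `|` [set E C a b] = S.
  apply: maxS; last exact: subsetUl.
  split=> [X [/indS//|->]|].
    by apply/indecomposableP; exists a, b; split=> //; exact: isomorphic_refl.
  move=> X Y [SX|->] [SY|->] XY //; first exact: famS.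
  - by split; [exact: cpt|exact: niso].
  - by split; [exact/compatibleC/cpt|move=> /isomorphic_sym; exact: niso].
apply: nin; split=> //; exists (E C a b); last exact: isomorphic_refl.
by rewrite -eT; right.
Qed.

Notation cw x y z := (ccw (\val x) (\val y) (\val z)).

Lemma cw_neq x y z : cw x y z -> [/\ x <> y, y <> z & x <> z].
Proof. by move=> /ccw_neq[h1 h2 h3]; split=> e; subst. Qed.

Lemma cw_total x y z : x <> y -> y <> z -> x <> z -> cw x y z \/ cw x z y.
Proof. by move=> *; apply: ccw_total; try exact: circleZ; exact: val_neq. Qed.

Lemma cw_trans z a b c : cw z a b -> cw z b c -> cw z a c.
Proof. by apply: ccw_trans; exact: circleZ. Qed.

Lemma cw_rebase z a b c : cw z a b -> cw z b c -> cw a b c.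
Proof. by apply: ccw_rebase; exact: circleZ. Qed.

Lemma cw_opposite x y a b : cw x a y -> cw y b x -> cw a y b /\ cw b x a.
Proof.
move=> xay ybx; split.
  by apply/ccwC/ccwC; apply: (cw_trans y b x a) => //; exact/ccwC/ccwC.
by apply/ccwC/ccwC; apply: (cw_trans x a y b) => //; exact/ccwC/ccwC.
Qed.

(** Non-crossing in terms of cyclic order, extended to the sides joining an element to its
    successor: these separate no two elements of [Z], one of their arcs being empty. *)
Lemma edge_noncross x y a b : edgeS x y -> edgeS a b -> cw x a y -> cw y b x -> False.
Proof.
move=> exy eab xay ybx; have [ayb bxa] := cw_opposite _ _ _ _ xay ybx.
case: exy => [ixy|[_ /(_ a)]//|[_ /(_ b)]//].
case: eab => [iab|[_ /(_ y)]//|[_ /(_ x)]//].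
by apply: (in_noncross x y a b) => //; apply: ccw_cross => //; exact: circleZ.
Qed.

Lemma edge_inside x y a b : edgeS x y -> edgeS a b -> cw x a y ->
  [\/ b = x, b = y | cw x b y].
Proof.
move=> exy eab xay.
have [->|bx] := pselect (b = x); first by constructor 1.
have [->|by_] := pselect (b = y); first by constructor 2.
constructor 3; have := edge_neq _ _ exy => xy.
have [//|xyb] := cw_total x b y (nesym bx) by_ xy.
by exfalso; apply: (edge_noncross x y a b) => //; exact: ccwC.
Qed.

Lemma edge_in_or_succ x y z : edgeS x y -> cw x y z -> inS x y \/ succ x y.
Proof. by case; [left|right|move=> [_ /(_ z) h] /ccwC]. Qed.

Lemma edge_in x y a b : edgeS x y -> cw x a y -> cw y b x -> inS x y.
Proof. by case=> // [[_ /(_ a)]|[_ /(_ b)]]. Qed.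

Lemma in_edge x y : inS x y -> edgeS x y.
Proof. by constructor 1. Qed.

(** As [a] is strictly between [x] and [y] and edges do not cross, both ends of [ab] are on the
    closed arc from [x] to [y]. The geodesic thus stays in the half disk cut off by [xy], and [q] is
    strictly on the other side. *)
Lemma geodesic_arc_disjoint x y z a b (q : R * R) : cw x y z -> edgeS x y ->
  inS a b -> cw x a y -> dot q q <= 1 ->
  (inS x y -> 0 < orient (\val x) (\val y) q) ->
  orient (\val a) (\val b) q <> 0.
Proof.
move=> xyz exy iab xay q1 hxy ab0.
have [cx cy ca cb] := And4 (circleZ x) (circleZ y) (circleZ a) (circleZ b).
have ixy := edge_in x y a z exy xay (ccwC _ _ _ xyz).
have [xa ay _] := cw_neq _ _ _ xay.
suff : orient (\val x) (\val y) q <= 0 by rewrite leNgt hxy.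
have ab0' : orient (\val a) (\val b) q <= 0 by rewrite ab0.
have ba0' : orient (\val b) (\val a) q <= 0 by rewrite orient_swap ab0 oppr0.
case: (edge_inside x y a b exy (in_edge _ _ iab) xay) => [e|e|xby].
- by apply: (half_disk_le _ (\val b) (\val a)) ba0' => //; [rewrite e; left|right].
- by apply: (half_disk_le _ (\val a) (\val b)) ab0' => //; [right; rewrite e|left; rewrite e].
- have [xb _ _] := cw_neq _ _ _ xby.
  have [xab|xba] := cw_total x a b xa (in_neq _ _ iab) xb.
    by apply: (half_disk_le _ (\val a) (\val b)) ab0' => //; right.
  by apply: (half_disk_le _ (\val b) (\val a)) ba0' => //; right.
Qed.

Definition tri_open x y z := open_tri (inS x y) (inS y z) (inS z x) (\val x) (\val y) (\val z).
Definition tri_closed x y z := closed_tri (inS x y) (inS y z) (inS z x) (\val x) (\val y) (\val z).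

Lemma tri_open_rot x y z : tri_open x y z = tri_open y z x.
Proof. by apply/seteqP; split=> p []. Qed.

Lemma triangle_rot x y z : triangle S x y z -> triangle S y z x.
Proof. by move=> [h1 h2 h3]; split=> //; exact: edgeC. Qed.

Lemma vertex_or_arc x y z a : cw x y z ->
  [\/ [set x; y; z] a, cw x a y, cw y a z | cw z a x].
Proof.
move=> xyz; case: (arc_cases _ _ _ (\val a) (circleZ x) (circleZ y) (circleZ z) (circleZ a) xyz).
- by move=> [/val_inj ->|[/val_inj ->|/val_inj ->]]; constructor 1;
    [left; left|left; right|right].
- by constructor 2.
- by constructor 3.
- by constructor 4.
Qed.

Lemma geodesic_tri_vertex x y z a b (p : R * R) : cw x y z -> triangle S x y z ->
  inS a b -> tri_open x y z p -> orient (\val a) (\val b) (klein p) = 0 ->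
  [set x; y; z] a.
Proof.
move=> xyz [exy eyz exz] iab [_ h1 h2 h3] o0.
have k1 := klein_disk p; have ezx := edgeC _ _ exz.
case: (vertex_or_arc _ _ _ a xyz) => // xay; exfalso.
- exact: (geodesic_arc_disjoint x y z a b (klein p)).
- exact: (geodesic_arc_disjoint y z x a b (klein p) (ccwC _ _ _ xyz)).
- exact: (geodesic_arc_disjoint z x y a b (klein p) (ccwC _ _ _ (ccwC _ _ _ xyz))).
Qed.

(** Both ends of the geodesic must be vertices of the triangle, so the geodesic is one of its sides,
    where the strict inequality of [tri_open] fails. *)
Lemma geodesic_tri_disjoint x y z a b (p : R * R) : cw x y z -> triangle S x y z ->
  inS a b -> tri_open x y z p -> orient (\val a) (\val b) (klein p) <> 0.
Proof.
move=> xyz txyz iab tp o0.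
have o0' : orient (\val b) (\val a) (klein p) = 0 by rewrite orient_swap o0 oppr0.
have va := geodesic_tri_vertex _ _ _ _ _ _ xyz txyz iab tp o0.
have vb := geodesic_tri_vertex _ _ _ _ _ _ xyz txyz (inC _ _ iab) tp o0'.
have ab := in_neq _ _ iab; have iba := inC _ _ iab.
case: tp => _ h1 h2 h3.
by case: va => [[|]|] /= ea; case: vb => [[|]|] /= eb; subst a b;
  (try by case: ab); (try by have := h1 iab; rewrite o0 ltxx);
  (try by have := h1 iba; rewrite o0' ltxx);
  (try by have := h2 iab; rewrite o0 ltxx);
  (try by have := h2 iba; rewrite o0' ltxx);
  (try by have := h3 iab; rewrite o0 ltxx);
  (try by have := h3 iba; rewrite o0' ltxx).
Qed.

(** The side [uw] separates [v] from [z], hence belongs to the cluster, and its sign condition puts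
    [q] beyond it. The half disk beyond [uw] is contained in the one beyond [xy]. *)
Lemma tri_arc_ordered x y z u v w (q : R * R) : cw x y z -> dot q q <= 1 ->
  triangle S u v w -> x = u \/ cw x u w -> w = y \/ cw x w y -> cw u v w -> cw w z u ->
  (inS w u -> 0 < orient (\val w) (\val u) q) ->
  orient (\val x) (\val y) q < 0.
Proof.
move=> xyz q1 [_ _ euw] xuw xwy uvw wzu hwu.
have iuw := edge_in u w v z euw uvw wzu.
have := hwu (inC _ _ iuw); rewrite orient_swap oppr_gt0 => h.
apply: (half_disk_lt _ (\val u) (\val w)) h => //; try exact: circleZ.
  by case: xuw => [->|]; [left|right].
by case: xwy => [->|]; [left|right].
Qed.

Lemma cw_unrebase x y z a : cw x y z -> cw x a y -> cw z x a /\ cw z a y.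
Proof.
move=> xyz xay; split.
  by have [] := cw_opposite x y a z xay (ccwC _ _ _ xyz).
by have [/ccwC/ccwC] := cw_opposite x y a z xay (ccwC _ _ _ xyz).
Qed.

Lemma cw_arc_order x y z u v w : cw x y z ->
  [\/ u = x, u = y | cw x u y] -> [\/ w = x, w = y | cw x w y] -> cw z u w ->
  [/\ x = u \/ cw x u w, w = y \/ cw x w y & cw w z u].
Proof.
move=> xyz hu hw zuw; have zxy := ccwC _ _ _ (ccwC _ _ _ xyz).
split; last exact/ccwC/ccwC.
  case: hu => [->|eu|xuy]; first by left.
    subst u; exfalso; case: hw => [ew|ew|xwy]; subst.
    - exact: (ccw_asymr _ _ _ zxy).
    - by have [_] := cw_neq _ _ _ zuw.
    - by have [_ /ccw_asymr] := cw_unrebase _ _ _ _ xyz xwy.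
  right; have [zxu _] := cw_unrebase _ _ _ _ xyz xuy.
  exact: (cw_rebase z x u w).
case: hw => [ew|->|]; [|by left|by right].
subst w; exfalso; case: hu => [eu|eu|xuy]; subst.
- by have [_] := cw_neq _ _ _ zuw.
- exact: (ccw_asymr _ _ _ zxy).
- by have [/ccw_asymr] := cw_unrebase _ _ _ _ xyz xuy.
Qed.

(** Non-crossing forces all three vertices [a], [b], [c] onto the closed arc from [x] to [y]. After
    a rotation they are increasing as seen from [z], and the side from the first to the last
    separates the triangle from [z]. *)
Lemma tri_arc_disjoint x y z a b c (q : R * R) : cw x y z -> edgeS x y -> dot q q <= 1 ->
  (inS x y -> 0 < orient (\val x) (\val y) q) ->
  cw a b c -> triangle S a b c -> cw x a y ->
  (inS a b -> 0 < orient (\val a) (\val b) q) ->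
  (inS b c -> 0 < orient (\val b) (\val c) q) ->
  (inS c a -> 0 < orient (\val c) (\val a) q) -> False.
Proof.
move=> xyz exy q1 hxy abc tabc xay hab hbc hca.
have [eab ebc eac] := tabc.
have ixy := edge_in x y a z exy xay (ccwC _ _ _ xyz).
have ia := Or33 (a = x) (a = y) xay.
have ib := edge_inside x y a b exy eab xay.
have ic := edge_inside x y a c exy eac xay.
have zne u : [\/ u = x, u = y | cw x u y] -> z <> u.
  have [xy yz xz] := cw_neq _ _ _ xyz.
  case=> [->|->|xuy] => [/esym//|/esym//|e]; subst u.
  exact: (ccw_asymr _ _ _ xyz).
have za := zne _ ia; have zb := zne _ ib; have zc := zne _ ic.
have [ab bc ac] := cw_neq _ _ _ abc.
have ord u v w : cw u v w -> cw z u v -> cw z u w -> cw z v w.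
  move=> uvw zuv zuw; have [_ vw _] := cw_neq _ _ _ uvw.
  have [_ _ zv] := cw_neq _ _ _ zuv; have [_ _ zw] := cw_neq _ _ _ zuw.
  have [//|zwv] := cw_total z v w zv vw zw; exfalso.
  exact: (ccw_asymr _ _ _ uvw (cw_rebase z u w v zuw zwv)).
suff : orient (\val x) (\val y) q < 0 by rewrite ltNge ltW// hxy.
have main u v w : cw u v w -> triangle S u v w -> [\/ u = x, u = y | cw x u y] ->
    [\/ w = x, w = y | cw x w y] -> cw z u w ->
    (inS w u -> 0 < orient (\val w) (\val u) q) -> orient (\val x) (\val y) q < 0.
  move=> uvw tuvw iu iw zuw hwu; have [h1 h2 h3] := cw_arc_order x y z u v w xyz iu iw zuw.
  exact: (tri_arc_ordered x y z u v w).
have bca := ccwC _ _ _ abc; have cab := ccwC _ _ _ bca.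
have tbca := triangle_rot _ _ _ tabc; have tcab := triangle_rot _ _ _ tbca.
have [zac|zca] := cw_total z a c za ac zc.
  have [zab|zba] := cw_total z a b za ab zb.
    exact: (main a b c).
  (* b < a < c contradicts the orientation, so the first vertex is b *)
  exfalso; exact: (ccw_asymr _ _ _ abc (ccwC _ _ _ (cw_rebase z b a c zba zac))).
have [zab|zba] := cw_total z a b za ab zb.
  apply: (main c a b) => //.
  exact: (cw_trans z c a b).
have [zbc|zcb] := cw_total z b c zb bc zc.
  exact: (main b c a).
exfalso; exact: (ccw_asymr _ _ _ abc (ccwC _ _ _ (ccwC _ _ _ (cw_rebase z c b a zcb zba)))).
Qed.

Lemma tri_vertex x y z a b c (p : R * R) : cw x y z -> triangle S x y z ->
  cw a b c -> triangle S a b c -> tri_open x y z p -> tri_open a b c p ->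
  [set x; y; z] a.
Proof.
move=> xyz [exy eyz exz] abc tabc [_ h1 h2 h3] [_ g1 g2 g3].
have k1 := klein_disk p; have ezx := edgeC _ _ exz.
case: (vertex_or_arc _ _ _ a xyz) => // xay; exfalso.
- exact: (tri_arc_disjoint x y z a b c (klein p)).
- exact: (tri_arc_disjoint y z x a b c (klein p) (ccwC _ _ _ xyz)).
- exact: (tri_arc_disjoint z x y a b c (klein p) (ccwC _ _ _ (ccwC _ _ _ xyz))).
Qed.

Lemma tri_disjoint x y z a b c (p : R * R) : cw x y z -> triangle S x y z ->
  cw a b c -> triangle S a b c -> tri_open x y z p -> tri_open a b c p ->
  [set x; y; z] = [set a; b; c].
Proof.
move=> xyz txyz abc tabc tp tp'.
have sub x' y' z' a' b' c' : cw x' y' z' -> triangle S x' y' z' ->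
    cw a' b' c' -> triangle S a' b' c' -> tri_open x' y' z' p -> tri_open a' b' c' p ->
    [set a'; b'; c'] `<=` [set x'; y'; z'].
  move=> h1 h2 h3 h4 h5 h6 w [[|]|] /= ->.
  - exact: (tri_vertex x' y' z' a' b' c' p).
  - apply: (tri_vertex x' y' z' b' c' a' p) => //; first exact: ccwC.
      exact: triangle_rot.
    by rewrite -tri_open_rot.
  - apply: (tri_vertex x' y' z' c' a' b' p) => //; first exact/ccwC/ccwC.
      exact/triangle_rot/triangle_rot.
    by rewrite tri_open_rot.
by apply/seteqP; split; apply: sub.
Qed.

(** If the starting points differ, the one closer to [p] lies strictly inside the other arc, which
    contains no element of [Z]; likewise for the end points. *)
Lemma succ_arc_disjoint x y a b (p : R * R) : circle R p -> succ x y -> succ a b ->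
  ccw (\val x) p (\val y) -> ccw (\val a) p (\val b) -> x = a /\ y = b.
Proof.
move=> cp [xy hxy] [ab hab] xpy apb.
have [cx cy ca cb] := And4 (circleZ x) (circleZ y) (circleZ a) (circleZ b).
have [px py _] := ccw_neq _ _ _ xpy; have [pa pb _] := ccw_neq _ _ _ apb.
have pyx := ccwC _ _ _ xpy; have pba := ccwC _ _ _ apb.
split; apply: contrapT => ne; have vne := val_neq _ _ ne.
- have [h|h] := ccw_total p _ _ cp cx ca (nesym px) vne (nesym pa).
    apply: (hxy a); apply: ccwC; exact: (ccw_rebase p (\val y) (\val x) (\val a)).
  apply: (hab x); apply: ccwC; exact: (ccw_rebase p (\val b) (\val a) (\val x)).
- have [h|h] := ccw_total p _ _ cp cy cb py vne pb.
    apply: (hab y); apply: ccwC; apply: ccwC; exact: (ccw_rebase p (\val y) (\val b) (\val a)).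
  apply: (hxy b); apply: ccwC; apply: ccwC; exact: (ccw_rebase p (\val b) (\val y) (\val x)).
Qed.

End Cluster.

(** * Continuity and injectivity *)

Section Realizations.
Context {R : realType} {V : choiceType} (K : set (set V)).
Implicit Types (q : realization R K) (s : set V).

Lemma bary_inj q q' : bary q = bary q' -> q = q'.
Proof.
case: q q' => b h1 h2 h3 [b' h1' h2' h3'] /= e; subst b'.
by congr Realization; exact: Prop_irrelevance.
Qed.

Lemma support_simplex q : K (Defs.support q).
Proof. exact: bary_simplex. Qed.

Lemma vertex_exists x : K [set x] -> exists q, Defs.support q = [set x].
Proof.
move=> Kx; pose b : {ptws V -> R} := fun v => (v == x)%:R.
have sb : [set v | b v != 0] = [set x].
  apply/seteqP; split=> v /=; rewrite /b; last by move=> ->; rewrite eqxx oner_eq0.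
  by rewrite pnatr_eq0 eqb0 negbK => /eqP.
have Kb : K [set v | b v != 0] by rewrite sb.
have b0 v : 0 <= b v by rewrite /b ler0n.
have bs : \sum_(v \in [set: V]) b v = 1.
  rewrite -(fsbig_widen [set x] setT)//=; first by rewrite fsbig_set1 /b eqxx.
  by move=> v [_ vx]; rewrite /b /=; have [e|//] := eqVneq v x; case: vx.
by exists (Realization b0 Kb bs).
Qed.

Lemma realization_openE (U : set (realization R K)) : open U = realization_open U.
Proof. by []. Qed.

(** The universal property of the weak topology. *)
Lemma continuous_realization (T : topologicalType) (f : realization R K -> T) :
  (forall s, K s -> {within closed_simplex R K s, continuous f}) -> continuous f.
Proof.
move=> cf; apply/continuousP => W oW; rewrite realization_openE => s Ks.
have := cf s Ks; move/continuousP => /(_ _ oW)/open_subspaceP[U oU eU].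
rewrite realization_openE in oU; have [W' [oW' eW']] := oU s Ks.
by exists W'; split=> //; rewrite -eU.
Qed.

End Realizations.

Section Psi.
Context {R : realType} {k : fieldType} {Z : set (R * R)}.
Context (C : canonicalCategory k Z) (S : set C).
Context (psi : realization R (clusterK S) -> disk R).
Hypotheses (aZ : admissible Z) (clS : is_cluster S) (psiP : is_psi psi).
Implicit Types (x y z a b c : Z) (p : R * R) (q : realization R (clusterK S)).

Notation inS := (in_up_to_iso S).
Notation edgeS := (edge S).
Notation cw x y z := (ccw (\val x) (\val y) (\val z)).
Notation simplex := (closed_simplex R (clusterK S)).
Let f q : R * R := \val (psi q).

Lemma clusterK1 x : clusterK S [set x].
Proof. by constructor 1; exists x. Qed.

Lemma clusterK2 x y : edgeS x y -> clusterK S [set x; y].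
Proof. by constructor 2; exists x, y. Qed.

Lemma clusterK3 x y z : triangle S x y z -> clusterK S [set x; y; z].
Proof. by constructor 3; exists x, y, z. Qed.

Lemma psi_vertex x q : simplex [set x] q -> f q = \val x.
Proof. by have [h _ _ _] := psiP; exact: h. Qed.

Lemma psi_succ x y : succ x y ->
  homeomorphism_onto (simplex [set x; y]) (Defs.arc (\val x) (\val y)) f.
Proof. by have [_ h _ _] := psiP; exact: h. Qed.

Lemma psi_in x y : inS x y ->
  homeomorphism_onto (simplex [set x; y]) (geodesic (\val x) (\val y)) f.
Proof. by have [_ _ h _] := psiP; exact: h. Qed.

Lemma psi_edge x y : edgeS x y ->
  exists B, homeomorphism_onto (simplex [set x; y]) B f.
Proof.
case=> h; first by exists (geodesic (\val x) (\val y)); exact: psi_in.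
  by exists (Defs.arc (\val x) (\val y)); exact: psi_succ.
by exists (Defs.arc (\val y) (\val x)); rewrite setUC; exact: psi_succ.
Qed.

(** [is_psi] provides homeomorphisms on edges and triangles only; a vertex is handled as a face of
    the edge to its successor. *)
Lemma psi_homeo s : clusterK S s -> exists s' B,
  [/\ clusterK S s', s `<=` s' & homeomorphism_onto (simplex s') B f].
Proof.
move=> [[x ->]|[x [y [exy ->]]]|[x [y [z [txyz ->]]]]].
- have [y xy] := succ_exists _ x aZ.
  exists [set x; y], (Defs.arc (\val x) (\val y)); split; last exact: psi_succ.
    by apply: clusterK2; constructor 2.
  by move=> w ->; left.
- have [B hB] := psi_edge x y exy; exists [set x; y], B; split=> //.
  exact: clusterK2.
- exists [set x; y; z]; eexists; split; [exact: clusterK3|by []|].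
  by have [_ _ _ h] := psiP; exact: h.
Qed.

Lemma simplexS s s' : s `<=` s' -> simplex s `<=` simplex s'.
Proof. by move=> ss q /= h; exact: subset_trans ss. Qed.

Lemma psi_within_continuous s : clusterK S s -> {within simplex s, continuous f}.
Proof.
move=> /psi_homeo[s' [B [_ ss [g [cf _ _ _]]]]].
by apply: continuous_subspaceW cf; exact: simplexS.
Qed.

Lemma psi_inj_simplex s q q' : clusterK S s -> simplex s q -> simplex s q' ->
  f q = f q' -> q = q'.
Proof.
move=> /psi_homeo[s' [B [_ ss [g [_ _ _ gf]]]]] sq sq' e.
by rewrite -(gf q) ?e ?gf//; exact: (simplexS _ _ ss).
Qed.

Lemma psi_continuous : continuous psi.
Proof.
apply: (@continuous_comp_initial _ _ _ set_val).
by apply: continuous_realization => s; exact: psi_within_continuous.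
Qed.

Lemma psi_curve x y z : edgeS x y -> cw x y z ->
  f @` simplex [set x; y] = curve (inS x y) (\val x) (\val y).
Proof.
move=> exy xyz; have [ixy|nxy] := pselect (inS x y).
  have [g [_ _ -> _]] := psi_in x y ixy.
  apply/seteqP; split=> p; first by left.
  by case=> -[].
have [//|sxy] := edge_in_or_succ C S x y z exy xyz.
have [g [_ _ -> _]] := psi_succ x y sxy.
apply/seteqP; split=> p; first by right.
by case=> -[].
Qed.

Lemma simplex_boundary3 x y z : x <> y -> y <> z -> x <> z ->
  simplex_boundary R (clusterK S) [set x; y; z] =
  simplex [set x; y] `|` simplex [set y; z] `|` simplex [set z; x].
Proof.
move=> xy yz xz; apply/seteqP; split=> q.
  move=> [/= sq nsq].
  have [sx|nx] := pselect (Defs.support q x); last first.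
    left; right => w sw; have := sq _ sw; case=> [[e|e]|e]; [|by left|by right].
    by case: nx; rewrite -e.
  have [sy|ny] := pselect (Defs.support q y); last first.
    right => w sw; have := sq _ sw; case=> [[e|e]|e]; [by right| |by left].
    by case: ny; rewrite -e.
  left; left => w sw; have := sq _ sw; case=> [[e|e]|e]; [by left|by right|].
  by case: nsq => v [[|]|] -> //; rewrite -e.
have prop s : s `<=` [set x; y; z] -> ~ [set x; y; z] `<=` s -> simplex s q ->
    simplex_boundary R (clusterK S) [set x; y; z] q.
  move=> s1 s2 sq; split; first exact: subset_trans s1.
  by move=> h; apply: s2; exact: subset_trans sq.
case=> [[|]|]; apply: prop.
- by move=> w ?; left.
- by move=> /(_ z (or_intror erefl))[/esym|/esym].
- by move=> w [->|->]; [left; right|right].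
- by move=> /(_ x (or_introl (or_introl erefl)))[].
- by move=> w [->|->]; [right|left; left].
- by move=> /(_ y (or_introl (or_intror erefl)))[|/esym].
Qed.

Lemma psi_triangle x y z : triangle S x y z -> cw x y z ->
  homeomorphism_onto (simplex [set x; y; z]) (tri_closed C S x y z) f.
Proof.
move=> txyz xyz; have [exy eyz exz] := txyz.
have [_ _ _ /(_ _ _ _ txyz)] := psiP.
rewrite simplex_boundary3; try exact: (edge_neq C S).
rewrite !image_setU (psi_curve x y z)// (psi_curve y z x)//; last exact: ccwC.
rewrite (psi_curve z x y); [|exact: edgeC|exact/ccwC/ccwC].
by rewrite enclosed_triangle//; exact: (circleZ aZ).
Qed.

Lemma vertex_point x : exists q, Defs.support q = [set x] /\ f q = \val x.
Proof.
have [q sq] := @vertex_exists R _ (clusterK S) x (clusterK1 x).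
by exists q; split=> //; apply: psi_vertex; rewrite /closed_simplex/= sq.
Qed.

Lemma psi_eq_vertex s q x : clusterK S s -> s x -> simplex s q -> f q = \val x ->
  Defs.support q = [set x].
Proof.
move=> Ks sx sq e; have [v [sv fv]] := vertex_point x.
have -> // : q = v; apply: (psi_inj_simplex s) => //; last by rewrite fv.
by rewrite /closed_simplex/= sv => _ ->.
Qed.

(** The map is injective on the closed simplex spanned by the support, and the proper faces already
    account for the vertices and boundary curves. A point with full support therefore lands in the
    open arc, open geodesic or open triangle. *)
Lemma psi_cell q :
  [\/ exists x, Defs.support q = [set x] /\ f q = \val x,
      exists x y, [/\ succ x y, Defs.support q = [set x; y], circle R (f q) &
                      ccw (\val x) (f q) (\val y)],
      exists x y, [/\ inS x y, Defs.support q = [set x; y], dot (f q) (f q) < 1 &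
                      orient (\val x) (\val y) (klein (f q)) = 0] |
      exists x y z, [/\ triangle S x y z, cw x y z, Defs.support q = [set x; y; z] &
                      tri_open C S x y z (f q)]].
Proof.
have sq : simplex (Defs.support q) q by [].
have Ks := support_simplex _ q.
have cell_succ x y : succ x y -> Defs.support q = [set x; y] ->
    circle R (f q) /\ ccw (\val x) (f q) (\val y).
  move=> sxy es; have [g [_ _ im _]] := psi_succ x y sxy.
  have [xy _] := sxy.
  have : Defs.arc (\val x) (\val y) (f q) by rewrite -im; exists q => //; rewrite /closed_simplex/= es.
  move=> [cf hf]; split=> //; case: hf => // e; exfalso; apply: xy.
    have sx : Defs.support q = [set x] by apply: (psi_eq_vertex _ _ _ Ks) => //; rewrite es; left.
    by have : [set x] y by rewrite -sx es; right.
  have sy : Defs.support q = [set y] by apply: (psi_eq_vertex _ _ _ Ks) => //; rewrite es; right.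
  by have : [set y] x by rewrite -sy es; left.
case: (Ks) => [[x es]|[x [y [exy es]]]|[x [y [z [txyz es]]]]].
- by constructor 1; exists x; split=> //; apply: psi_vertex; rewrite /closed_simplex/= -es.
- case: exy => [ixy|sxy|syx].
  + constructor 3; exists x, y; have [g [_ _ im _]] := psi_in x y ixy.
    have xy := in_neq _ _ _ _ ixy; have vxy := val_neq _ _ xy.
    have gq : geodesic (\val x) (\val y) (f q).
      by rewrite -im; exists q => //; rewrite /closed_simplex/= es.
    have [cx cy] := (circleZ aZ x, circleZ aZ y).
    have [dq o0] := (geodesicP _ _ _ cx cy vxy).1 gq; split=> //.
    case: (disk_circle_or_int _ dq) => // cq; exfalso; apply: xy.
    case: (geodesic_circle _ _ _ cx cy vxy gq cq) => e.
      have sx : Defs.support q = [set x] by apply: (psi_eq_vertex _ _ _ Ks) => //; rewrite es; left.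
      by have : [set x] y by rewrite -sx es; right.
    have sy : Defs.support q = [set y] by apply: (psi_eq_vertex _ _ _ Ks) => //; rewrite es; right.
    by have : [set y] x by rewrite -sy es; left.
  + by constructor 2; exists x, y; have [] := cell_succ x y sxy es.
  + rewrite setUC in es; constructor 2; exists y, x.
    by have [] := cell_succ y x syx es.
- constructor 4.
  (* A simplex is an unordered set of vertices, whereas [tri_open] needs them in positive order;
     exchanging two of them achieves this. *)
  wlog xyz : x y z txyz es / cw x y z.
    move=> h; have [exy eyz exz] := txyz.
    have xy := edge_neq _ _ _ _ exy; have yz := edge_neq _ _ _ _ eyz.
    have xz := edge_neq _ _ _ _ exz.
    have [xyz|xzy] := cw_total aZ x y z xy yz xz; first exact: (h x y z).
    apply: (h x z y) => //; first by split=> //; exact: edgeC.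
    by rewrite es -!setUA [X in _ `|` X]setUC.
  exists x, y, z; split=> //; have [g [_ _ im _]] := psi_triangle x y z txyz xyz.
  have [exy eyz exz] := txyz; have [xy yz xz] := cw_neq _ _ _ xyz.
  have [cx cy cz] := And3 (circleZ aZ x) (circleZ aZ y) (circleZ aZ z).
  apply: closed_tri_diff => //; split.
    by rewrite -/(tri_closed C S x y z) -im; exists q => //; rewrite /closed_simplex/= es.
  rewrite -(psi_curve x y z)// -(psi_curve y z x)//; last exact: ccwC.
  rewrite -(psi_curve z x y); [|exact: edgeC|exact/ccwC/ccwC].
  have sub s : s `<=` Defs.support q -> ~ Defs.support q `<=` s -> ~ (f @` simplex s) (f q).
    move=> ss nss [q' sq' e]; apply: nss.
    have -> // : q = q'; apply: (psi_inj_simplex _ _ _ Ks) => //.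
    exact: subset_trans ss.
  rewrite es in sub; case=> [[]|]; apply: sub.
  - by move=> w ?; left.
  - by move=> /(_ z (or_intror erefl))[/esym|/esym].
  - by move=> w [->|->]; [left; right|right].
  - by move=> /(_ x (or_introl (or_introl erefl)))[].
  - by move=> w [->|->]; [right|left; left].
  - by move=> /(_ y (or_introl (or_intror erefl)))[|/esym].
Qed.

(** The sixteen pairs of cells are compared. Cells of different kinds are told apart by circle
    against interior, or by disjointness of geodesics and triangles; two cells of the same kind with
    a common point are equal. *)
Lemma psi_support q q' : f q = f q' -> Defs.support q = Defs.support q'.
Proof.
move=> e.
have int p : circle R p -> dot p p < 1 -> False by rewrite /circle/= => ->; rewrite ltxx.
case: (psi_cell q) => [[x [-> fx]]|[x [y [sxy -> cq xqy]]]|[x [y [ixy -> iq oq]]]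
  |[x [y [z [txyz xyz -> tq]]]]];
case: (psi_cell q') => [[a [-> fa]]|[a [b [sab -> cq' aqb]]]|[a [b [iab -> iq' oq']]]
  |[a [b [c [tabc abc -> tq']]]]].
- by congr set1; apply: val_inj; rewrite -fx e fa.
- by case: sab => _ /(_ x); rewrite -fx e.
- by exfalso; apply: (int (f q')) => //; rewrite -e fx; exact: circleZ.
- by exfalso; case: tq' => iq' _ _ _; apply: (int (f q')) => //; rewrite -e fx; exact: circleZ.
- by case: sxy => _ /(_ a); rewrite -fa -e.
- have aqb' : ccw (\val a) (f q) (\val b) by rewrite e.
  by have [-> ->] := succ_arc_disjoint aZ x y a b (f q) cq sxy sab xqy aqb'.
- by exfalso; apply: (int (f q')) => //; rewrite -e.
- by exfalso; case: tq' => iq' _ _ _; apply: (int (f q')) => //; rewrite -e.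
- by exfalso; apply: (int (f q)) => //; rewrite e fa; exact: circleZ.
- by exfalso; apply: (int (f q)) => //; rewrite e.
- have := in_noncross C S aZ clS x y a b ixy iab => nc.
  have [cx cy ca cb] := And4 (circleZ aZ x) (circleZ aZ y) (circleZ aZ a) (circleZ aZ b).
  have xy := val_neq _ _ (in_neq _ _ _ _ ixy); have ab := val_neq _ _ (in_neq _ _ _ _ iab).
  have eg : geodesic (\val x) (\val y) = geodesic (\val a) (\val b).
    apply: contrapT => ne; apply: nc; split=> //; exists (f q); split=> //.
      by apply/geodesicP => //; split=> //; exact: ltW.
    by apply/geodesicP => //; rewrite e; split=> //; exact: ltW.
  case: (geodesic_inj _ _ _ _ cx cy xy ca cb ab eg) => -[/val_inj -> /val_inj ->] //.
  by rewrite setUC.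
- exfalso; apply: (geodesic_tri_disjoint C S aZ clS a b c x y (f q)) => //.
  by rewrite e.
- by exfalso; case: tq => iq _ _ _; apply: (int (f q)) => //; rewrite e fa; exact: circleZ.
- by exfalso; case: tq => iq _ _ _; apply: (int (f q)) => //; rewrite e.
- exfalso; apply: (geodesic_tri_disjoint C S aZ clS x y z a b (f q)) => //.
  by rewrite e.
- by apply: (tri_disjoint C S aZ clS x y z a b c (f q)) => //; rewrite e.
Qed.

Lemma psi_val_inj q q' : f q = f q' -> q = q'.
Proof.
move=> e; apply: (psi_inj_simplex (Defs.support q)) => //; first exact: support_simplex.
by rewrite /closed_simplex/= (psi_support _ _ e).
Qed.

Lemma psi_injective : injective psi.
Proof. by move=> q q' /(congr1 \val); exact: psi_val_inj. Qed.

End Psi.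

(** * Topological tools, and points of a geodesic close to its endpoint *)

Section SubspaceFacts.
Context {R : realType}.
Implicit Types (A : set (R * R)).

Lemma nbhs_set_type A (d : A) (U : set A) : nbhs d U ->
  exists O : set (R * R), [/\ open O, O (\val d) & forall e : A, O (\val e) -> U e].
Proof. by move=> [B [[W oW <-] Bd BU]]; exists W; split=> // e We; exact: BU. Qed.

Lemma set_type_nbhs A (d : A) (U : set A) (O : set (R * R)) :
  open O -> O (\val d) -> (forall e : A, O (\val e) -> U e) -> nbhs d U.
Proof. by move=> opO Od OU; exists (set_val @^-1` O); split=> //; exists O. Qed.

Lemma ptws_finite_closed (V : choiceType) (B : set {ptws V -> R}) : finite_set B -> closed B.
Proof.
have h : hausdorff_space {ptws V -> R}.
  by apply: (@hausdorff_product V (fun=> R)) => ?; exact: Rhausdorff.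
by move=> fB; exact: (accessible_finite_set_closed.1 (hausdorff_accessible h)).
Qed.

Lemma homeomorphism_closed_image (X : topologicalType) (s U : set X) (B : set (R * R))
    (f : X -> R * R) : homeomorphism_onto s B f -> closed B -> open U ->
  closed (f @` (s `\` U)).
Proof.
move=> [g [_ cg im gf]] cB oU.
have /closed_subspaceP[V cV eV] : closed (g @^-1` (~` U) : set (subspace B)).
  by move/continuous_closedP: cg => /(_ _ (open_closedC oU)).
have -> : f @` (s `\` U) = g @^-1` (~` U) `&` B.
  apply/seteqP; split=> [_ [x [sx Ux] <-]|p [gp Bp]].
    by split; [rewrite /= gf|rewrite -im; exists x].
  move: Bp gp; rewrite -im => -[x sx <-] /=; rewrite gf// => Ux.
  by exists x.
by rewrite -eV; exact: closedI.
Qed.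

Lemma continuous_poincare : continuous (@poincare R).
Proof.
have cd : continuous (fun p : R * R => (1 + Num.sqrt (1 - dot p p))^-1 : R).
  move=> p; apply: cvgV; first by rewrite gt_eqF// ltr_wpDr// sqrtr_ge0.
  apply: cvgD; first exact: cvg_cst.
  apply: (continuous_comp (f := fun p => 1 - dot p p)); last exact: sqrt_continuous.
  by apply: cvgB; [exact: cvg_cst|apply: (continuous_dot _ id id) => ?; exact: cvg_id].
apply: continuous_pair => p; apply: cvgM; try exact: cd.
  exact: continuous_fst2.
exact: continuous_snd2.
Qed.

Lemma geodesic_near (x y : R * R) (e : R) : circle R x -> circle R y -> x <> y -> 0 < e ->
  exists p, [/\ geodesic x y p, dot p p < 1 & ball x e p].
Proof.
move=> cx cy xy e0.
have ct : continuous (fun t => poincare (chord_point x y t)).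
  move=> t; apply: continuous_comp; first exact: continuous_chord_point.
  exact: continuous_poincare.
have : nbhs (0 : R) ((fun t => poincare (chord_point x y t)) @^-1` ball x e).
  apply: ct; rewrite chord_point0 poincare_circle//; exact: nbhsx_ballx.
move=> /nbhs_ballP[r /= r0 hr].
(* The bound [r / 2] keeps the point in the ball, and [1 / 2] keeps the parameter below 1, hence the
   point inside the disk. *)
pose t := Num.min (r / 2) (1 / 2).
have t0 : 0 < t by rewrite lt_min !divr_gt0.
have tr : t <= r / 2 by rewrite ge_min lexx.
have t1 : t <= 1 / 2 by rewrite ge_min lexx orbT.
have l0 : 0 < lam x y by apply: lam_gt0 => //; exact: circle_disk.
have k1 : dot (chord_point x y t) (chord_point x y t) < 1.
  rewrite dot_chord_point// gtrBl !mulr_gt0//; lra.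
exists (poincare (chord_point x y t)); split.
- apply/geodesicP => //; split; first exact/poincare_disk/ltW.
  by rewrite poincareK ?ltW// orient_chord_point orientl orientr !mulr0 addr0.
- exact: poincare_int.
- by apply: hr; rewrite /ball/= sub0r normrN gtr0_norm//; lra.
Qed.

Lemma finite_argmin (T : choiceType) (A : set T) (g : T -> R) : finite_set A -> A !=set0 ->
  exists2 x, A x & forall y, A y -> g x <= g y.
Proof.
move=> /finite_seqP[s ->]; elim: s => [[x]//|a s ih] _.
have [[b sb]|n] := pselect ([set` s] !=set0).
  have [x sx hx] := ih (ex_intro _ b sb).
  have [ax|xa] := leP (g a) (g x).
    exists a; first by rewrite /= mem_head.
    move=> y /=; rewrite inE => /orP[/eqP ->//|/hx]; exact: le_trans.
  exists x; first by rewrite /= inE sx orbT.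
  by move=> y /=; rewrite inE => /orP[/eqP ->|/hx//]; exact: ltW.
exists a; first by rewrite /= mem_head.
by move=> y /=; rewrite inE => /orP[/eqP ->//|sy]; exfalso; apply: n; exists y.
Qed.

End SubspaceFacts.

(** * Homeomorphisms and local finiteness *)

Section NotLocallyFinite.
Context {R : realType} {k : fieldType} {Z : set (R * R)}.
Context (C : canonicalCategory k Z) (S : set C).
Context (psi : realization R (clusterK S) -> disk R).
Hypotheses (aZ : admissible Z) (clS : is_cluster S) (psiP : is_psi psi).
Implicit Types (x y z a b c : Z) (p : R * R) (q : realization R (clusterK S)).

Notation inS := (in_up_to_iso S).
Notation simplex := (closed_simplex R (clusterK S)).
Let f q : R * R := \val (psi q).

Lemma clusterK_finite s : clusterK S s -> finite_set s.
Proof.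
by move=> [[x ->]|[x [y [_ ->]]]|[x [y [z [_ ->]]]]]; rewrite ?finite_setU;
  do ?split; exact: finite_set1.
Qed.

(** [locally_finite] counts objects of [S] while the construction needs neighbours. Members of a
    cluster are pairwise nonisomorphic, so each object at [x] is the one chosen for its other
    endpoint. *)
Lemma neighbours_infinite x :
  infinite_set [set X | S X /\ exists y, Defs.diagonal x y /\ isomorphic X (E C x y)] ->
  infinite_set [set y | inS x y].
Proof.
apply: contra_not => fN; have [[_ famS] _] := clS.
have /choice[h hh] : forall y, exists X, inS x y -> S X /\ isomorphic X (E C x y).
  move=> y; have [[_ [X SX iX]]|n] := pselect (inS x y); first by exists X.
  by exists (E C x y).
apply: (sub_finite_set _ (finite_image h fN)) => X [SX [y [dxy iX]]].
have ixy : inS x y by split=> //; exists X.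
exists y => //; have [Sh ih] := hh _ ixy; apply: contrapT => ne.
have [_] := famS _ _ Sh SX ne; apply.
exact: isomorphic_trans ih (isomorphic_sym _ _ iX).
Qed.

Lemma homeomorphism_locally_finite :
  homeomorphism_onto [set: realization R (clusterK S)] (range psi) psi ->
  locally_finite S.
Proof.
move=> [g [_ cg _ gpsi]] x; apply: contrapT => /neighbours_infinite/infiniteP/card_leP[y_].
pose y n : Z := \val (y_ (exist _ n (mem_set I))).
have yN n : inS x (y n) by exact: set_valP.
have yinj : injective y.
  by move=> n m /val_inj/(@inj _ _ _ y_) -/(_ (mem_set I) (mem_set I))/(congr1 val).
have cx := circleZ aZ x.
have /choice[q hq] : forall n, exists q, [/\ simplex [set x; y n] q,
    dot (f q) (f q) < 1 & ball (\val x) (n.+1%:R^-1) (f q)].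
  move=> n; have [g' [_ _ im _]] := psi_in C S psi psiP x (y n) (yN n).
  have [p [gp ip bp]] := geodesic_near (\val x) (\val (y n)) n.+1%:R^-1 cx
    (circleZ aZ (y n)) (val_neq _ _ (in_neq _ _ _ _ (yN n))) ltac:(by rewrite invr_gt0).
  by move: gp; rewrite -im => -[q' sq' e]; exists q'; rewrite /f e.
(* Otherwise the support would reduce to [x], and the image would be on the circle instead of inside
   the disk. *)
have yq n : Defs.support (q n) (y n).
  apply: contrapT => ny; have [sq iq _] := hq n.
  have : f (q n) = \val x.
    apply: (psi_vertex C S psi psiP) => w sw; case: (sq _ sw) => // e.
    by case: ny; rewrite -e.
  by move=> e; move: iq; rewrite e cx ltxx.
(* A simplex has finitely many vertices and [q n] has the vertex [y n] in its support, so each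
   simplex contains only finitely many of the chosen points, which form a closed set. *)
have oQ : open (~` range q).
  rewrite realization_openE => s Ks.
  have fin : finite_set (range q `&` simplex s).
    apply: (@sub_finite_set _ _ (q @` (y @^-1` s))).
      by move=> _ [[n _ <-] sn]; exists n => //; exact: sn.
    apply: finite_image; apply: finite_preimage; last exact: clusterK_finite.
    by move=> ? ? _ _; exact: yinj.
  exists (~` (@bary R _ (clusterK S) @` (range q `&` simplex s))); split.
    by apply: closed_openC; apply: ptws_finite_closed; exact: finite_image.
  apply/seteqP; split=> r [h sr]; split=> //.
    by move=> [r' [Qr' sr'] /bary_inj e]; apply: h; rewrite -e.
  by move=> Qr; apply: h; exists r.
have [v [_ fv]] := vertex_point C S psi psiP x.
have nv : (~` range q) v.
  by move=> [n _ e]; have [_ + _] := hq n; rewrite e /f fv cx ltxx.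
have : nbhs (g (psi v)) (~` range q) by rewrite gpsi//; exact: open_nbhs_nbhs.
have Rv : range psi (psi v) by exists v.
move/subspace_continuousP: cg => /(_ _ Rv) cg /cg.
move=> /nbhs_set_type[W [oW Wv hW]].
have /nbhs_ballP[e /= e0 he] : nbhs (\val x) W by apply: open_nbhs_nbhs; split=> //; rewrite -fv.
pose n := Num.trunc e^-1.
have ne : n.+1%:R^-1 < e.
  by rewrite invf_plt ?posrE// truncnS_gt.
have [_ _ bn] := hq n.
have := hW (psi (q n)); apply.
- by apply: he; apply: le_ball bn; exact: ltW.
- by exists (q n).
- by exists n => //; exact/esym/gpsi.
Qed.

End NotLocallyFinite.

(** * The star of a vertex: consecutive neighbours and the triangles they span *)

Section Star.
Context {R : realType} {k : fieldType} {Z : set (R * R)}.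
Context (C : canonicalCategory k Z) (S : set C).
Hypotheses (aZ : admissible Z) (clS : is_cluster S).
Implicit Types (x y z a b c u v w : Z) (p : R * R).

Notation inS := (in_up_to_iso S).
Notation edgeS := (edge S).
Notation cw x y z := (ccw (\val x) (\val y) (\val z)).

Lemma succ_unique z y y' : succ z y -> succ z y' -> y = y'.
Proof.
move=> [zy hy] [zy' hy']; apply: contrapT => ne.
by have [/hy'|/hy] := cw_total aZ z y y' zy ne zy'.
Qed.

Lemma pred_unique z y y' : succ y z -> succ y' z -> y = y'.
Proof.
move=> [yz hy] [yz' hy']; apply: contrapT => ne.
have [/ccwC/ccwC|] := cw_total aZ z y y' (nesym yz) ne (nesym yz').
  by move=> /ccwC/ccwC/hy.
by move=> /ccwC/ccwC/ccwC/ccwC/hy'.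
Qed.

(** An object determines its second endpoint once [z] is fixed, by [isomorphic_E]; the successor and
    predecessor add at most two neighbours. *)
Lemma neighbours_finite z : locally_finite S -> finite_set [set y | edgeS z y].
Proof.
move=> /(_ z) fin.
have /choice[h hh] : forall X : C, exists y,
    (exists y', Defs.diagonal z y' /\ isomorphic X (E C z y')) ->
    Defs.diagonal z y /\ isomorphic X (E C z y).
  move=> X; have [[y' hy']|n] := pselect (exists y', Defs.diagonal z y' /\ isomorphic X (E C z y')).
    by exists y'.
  by exists z => /n.
have [zs szs] := succ_exists _ z aZ; have [zp szp] := pred_exists _ z aZ.
apply: (@sub_finite_set _ _ (h @` [set X | S X /\
    exists y, Defs.diagonal z y /\ isomorphic X (E C z y)] `|` [set zs; zp])).
  move=> y [[dzy [X SX iX]]|szy|syz].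
  - left; have hX : exists y', Defs.diagonal z y' /\ isomorphic X (E C z y') by exists y.
    exists X; first by split.
    have [dh ih] := hh X hX.
    have : isomorphic (E C z (h X)) (E C z y).
      exact: isomorphic_trans (isomorphic_sym _ _ ih) iX.
    move=> /isomorphic_E -/(_ dh dzy)[[]//|[ezy _]].
    by exfalso; case: dzy => ne _ _; apply: ne; rewrite -ezy.
  - by right; left; exact: succ_unique szy szs.
  - by right; right; exact: pred_unique syz szp.
by rewrite finite_setU; split; [exact: finite_image|rewrite finite_setU; split; exact: finite_set1].
Qed.

Definition consecutive z y y' := [/\ edgeS z y, edgeS z y', cw z y y' &
  forall w, edgeS z w -> cw z y w -> cw z w y' -> False].

(** A cluster geodesic [cd] crossing [yy'] would have an end [c] strictly between [y] and [y']. If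
    [d = z], then [c] is a neighbour of [z] in the gap; otherwise [cd] crosses [zy] or [zy'].
    Maximality then adds [yy']. *)
Lemma consecutive_edge z y y' : consecutive z y y' -> edgeS y y'.
Proof.
move=> [ezy ezy' zyy' gap].
have [zy yy' zy'] := cw_neq _ _ _ zyy'.
have yy'z := ccwC _ _ _ zyy'.
have [s|ns] := pselect (succ y y'); first by constructor 2.
have ns' : ~ succ y' y by move=> [_ /(_ z)]; apply; exact/ccwC.
constructor 1; apply: in_maximal => //; first by split=> // e; apply: yy'.
move=> c d icd /cross_ccw h.
have := h (circleZ aZ y) (circleZ aZ y') (circleZ aZ c) (circleZ aZ d)
  (val_neq _ _ yy') (val_neq _ _ (in_neq _ _ _ _ icd)) => {h}.
wlog : c d icd / cw y c y' /\ cw y' d y.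
  move=> h [hcd|hdc]; first by apply: (h c d) => //; left.
  by apply: (h d c) => //; [exact: inC|left].
move=> [ycy' y'dy] _.
have ecd := in_edge _ _ _ _ icd.
have [zyc zcy'] : cw z y c /\ cw z c y' by exact: (cw_unrebase aZ y y' z c).
have [dz|dz] := pselect (d = z).
  by subst d; exact: (gap c (edgeC _ _ _ _ ecd)).
have [_ dy _] := cw_neq _ _ _ y'dy; have [y'd _ _] := cw_neq _ _ _ y'dy.
have [zdy|zyd] := cw_total aZ z d y (nesym dz) dy zy.
  apply: (edge_noncross C S aZ clS z y d c) => //; first exact: edgeC.
  exact: ccwC.
apply: (edge_noncross C S aZ clS z y' c d) => //.
have [h|h] := cw_total aZ z d y' (nesym dz) (nesym y'd) zy'; last exact/ccwC.
exfalso; have := cw_rebase aZ z y d y' zyd h => ydy'.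
by apply: (ccw_asymr _ _ _ ydy'); exact/ccwC/ccwC.
Qed.

Lemma consecutive_triangle z y y' : consecutive z y y' -> triangle S z y y'.
Proof. by move=> h; have [? ? _ _] := h; split=> //; exact: consecutive_edge h. Qed.

Lemma slopeZ z a b : a <> z -> b <> z ->
  cw z a b <-> slope (\val z) (\val a) < slope (\val z) (\val b).
Proof.
by move=> az bz; apply: ccw_slope; try exact: circleZ aZ _; exact: val_neq.
Qed.

Lemma next_exists z y w : locally_finite S -> edgeS z y -> edgeS z w -> cw z y w ->
  exists y', consecutive z y y'.
Proof.
move=> lf ezy ezw zyw.
have finA : finite_set [set v | edgeS z v /\ cw z y v].
  by apply: sub_finite_set (neighbours_finite z lf) => v [].
have [y' [ezy' zyy'] hmin] := finite_argmin _ _ (fun v : Z => slope (\val z) (\val v)) finA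
  (ex_intro _ w (conj ezw zyw)).
exists y'; split=> // v ezv zyv zvy'.
have := hmin v (conj ezv zyv); rewrite leNgt => /negP; apply.
by apply/slopeZ => //; exact/nesym/(edge_neq C S).
Qed.

Lemma prev_exists z y' w : locally_finite S -> edgeS z y' -> edgeS z w -> cw z w y' ->
  exists y, consecutive z y y'.
Proof.
move=> lf ezy' ezw zwy'.
have finA : finite_set [set v | edgeS z v /\ cw z v y'].
  by apply: sub_finite_set (neighbours_finite z lf) => v [].
have [y [ezy zyy'] hmin] := finite_argmin _ _ (fun v : Z => - slope (\val z) (\val v)) finA
  (ex_intro _ w (conj ezw zwy')).
exists y; split=> // v ezv zyv zvy'.
have := hmin v (conj ezv zvy'); rewrite lerN2 leNgt => /negP; apply.
by apply/slopeZ => //; exact/nesym/(edge_neq C S).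
Qed.

Lemma succ_first z zs w : succ z zs -> w <> z -> w <> zs -> cw z zs w.
Proof.
move=> [zzs h] wz ws.
by have [//|/h] := cw_total aZ z zs w zzs (nesym ws) (nesym wz).
Qed.

Lemma pred_last z zp w : succ zp z -> w <> z -> w <> zp -> cw z w zp.
Proof.
move=> [zpz h] wz wp.
by have [//|/ccwC/h] := cw_total aZ z w zp (nesym wz) wp (nesym zpz).
Qed.

Lemma succ_neq_pred z zs zp : succ z zs -> succ zp z -> zs <> zp.
Proof.
move=> ss sp e; subst zp.
have [w Zw [wz ws]] := admissible_other _ aZ (\val z) (\val zs).
pose w' : Z := exist _ w (mem_set Zw).
have wz' : w' <> z by move=> e; apply: wz; rewrite -e.
have ws' : w' <> zs by move=> e; apply: ws; rewrite -e.
exact: (ccw_asymr _ _ _ (succ_first z zs w' ss wz' ws') (pred_last z zs w' sp wz' ws')).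
Qed.

Lemma in_not_succ x y : inS x y -> ~ succ x y.
Proof. by move=> /in_diagonal[]. Qed.

(** The finitely many chords at [z] cut the disk into sectors. The last neighbour [y] with [p] on or
    to the left of [zy], together with the next one, gives the triangle; the side opposite to [z] is
    covered by the hypothesis. *)
Lemma star_cover z p : locally_finite S -> disk R p ->
  (forall y y', consecutive z y y' -> inS y y' -> 0 <= orient (\val y) (\val y') (klein p)) ->
  exists y y', consecutive z y y' /\ tri_closed C S z y y' p.
Proof.
move=> lf dp side_ge0.
have [zs szs] := succ_exists _ z aZ; have [zp szp] := pred_exists _ z aZ.
have ezs : edgeS z zs by constructor 2.
have ezp : edgeS z zp by constructor 3.
have sp := succ_neq_pred z zs zp szs szp.
have ne w : edgeS z w -> w <> z by move=> /edge_neq/nesym.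
have zsp : cw z zs zp by apply: succ_first; [|exact: ne|exact: nesym].
have k1 := klein_disk p; have cz := circleZ aZ z.
have later y y' : cw z y y' -> orient (\val z) (\val y) (klein p) < 0 ->
    orient (\val z) (\val y') (klein p) < 0.
  move=> zyy'; apply: half_disk_r_lt => //; exact: circleZ.
(* Here [p] is between the chord from [z] to its successor and the circle. The first triangle still
   contains it, since its side along the arc imposes no condition. *)
have [os|os] := ltP (orient (\val z) (\val zs) (klein p)) 0.
  have [y' cy'] := next_exists z zs zp lf ezs ezp zsp.
  exists zs, y'; split=> //; have [_ _ zsy' _] := cy'; split=> //.
  - by move=> /in_not_succ.
  - exact: side_ge0.
  - by move=> _; rewrite orient_swap oppr_ge0 ltW// (later zs).
pose A := [set y | edgeS z y /\ 0 <= orient (\val z) (\val y) (klein p)].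
have finA : finite_set A by apply: sub_finite_set (neighbours_finite z lf) => v [].
have [y [ezy oy] ymax] := finite_argmin _ _ (fun v : Z => - slope (\val z) (\val v)) finA
  (ex_intro _ zs (conj ezs os)).
(* The symmetric case at the other end: [p] is in the sliver along the arc from the predecessor to
   [z] and belongs to the last triangle. *)
have [eyp|nyp] := pselect (y = zp).
  subst y; have [y cy] := prev_exists z zp zs lf ezp ezs zsp.
  exists y, zp; split=> //; have [_ _ zyp _] := cy; split=> //.
  - by move=> _; rewrite leNgt; apply/negP => /(later _ _ zyp); rewrite ltNge oy.
  - exact: side_ge0.
  - by move=> /in_not_succ.
have zyp : cw z y zp by apply: pred_last => //; exact: ne.
have [y' cy'] := next_exists z y zp lf ezy ezp zyp.
exists y, y'; split=> //; have [_ ezy' zyy' _] := cy'; split=> //.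
  exact: side_ge0.
move=> _; rewrite orient_swap oppr_ge0 leNgt; apply/negP => oy'.
have := ymax y' (conj ezy' (ltW oy')); rewrite lerN2 leNgt => /negP; apply.
by apply/slopeZ => //; exact: ne.
Qed.

Section Side.
Variables (z y y' : Z) (p : R * R).
Hypotheses (cyy' : consecutive z y y') (iyy' : inS y y').

Let cz := circleZ aZ z.
Let cy := circleZ aZ y.
Let cy' := circleZ aZ y'.
Let zyy' : cw z y y'. Proof. by case: cyy'. Qed.

Lemma side_vertex : 0 < orient (\val y) (\val y') (klein (\val z)).
Proof. by rewrite klein_circle// -orientC. Qed.

Lemma side_succ a : circle R p -> succ z a -> ccw (\val z) p (\val a) ->
  0 < orient (\val y) (\val y') (klein p).
Proof.
move=> cp sza zpa; rewrite klein_circle// -orientC -ccwE.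
have zpy : ccw (\val z) p (\val y).
  have [->//|ya] := pselect (y = a).
  apply: (ccw_trans _ _ (\val a)) => //; try exact: circleZ.
  by apply: succ_first => //; apply/nesym; have [+ _ _] := cw_neq _ _ _ zyy'.
exact: (ccw_rebase (\val z)).
Qed.

Lemma side_pred a : circle R p -> succ a z -> ccw (\val a) p (\val z) ->
  0 < orient (\val y) (\val y') (klein p).
Proof.
move=> cp saz apz; rewrite klein_circle// -ccwE.
have zap := ccwC _ _ _ (ccwC _ _ _ apz).
have zy'p : ccw (\val z) (\val y') p.
  have [->//|y'a] := pselect (y' = a).
  apply: (ccw_trans _ _ (\val a)) => //; try exact: circleZ.
  by apply: pred_last => //; apply/nesym; have [_ _ +] := cw_neq _ _ _ zyy'.
exact: (ccw_rebase (\val z)).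
Qed.

Hypothesis ip : dot p p < 1.

Let ik := klein_int p ip.

(** A point on or beyond the chord [yy'] lies strictly within the sector at [z] between [zy] and
    [zy']: the half disk of [yy'] is contained in those of [zy'] and [yz]. *)
Let beyond : orient (\val y) (\val y') (klein p) <= 0 ->
  orient (\val z) (\val y') (klein p) < 0 /\ orient (\val y) (\val z) (klein p) < 0.
Proof.
move=> h; split.
  exact: (half_disk_l_int (\val z) (\val y)).
by apply: (half_disk_r_int (\val y) (\val y')) => //; exact: ccwC.
Qed.

(** Otherwise [p] would be in the sector between [zy] and [zy'], and the geodesic from [z] through
    [p] would end at a neighbour strictly between [y] and [y']. *)
Lemma side_geodesic a : edgeS z a -> orient (\val z) (\val a) (klein p) = 0 ->
  0 < orient (\val y) (\val y') (klein p).
Proof.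
move=> eza o0; rewrite ltNge; apply/negP => /beyond[h1 h2].
have [_ _ _ gap] := cyy'; have [zy yy' zy'] := cw_neq _ _ _ zyy'.
have za := edge_neq _ _ _ _ eza; have ca := circleZ aZ a.
have [ay|ay] := pselect (a = y).
  by move: h2; rewrite -ay orient_swap o0 oppr0 ltxx.
have [ay'|ay'] := pselect (a = y').
  by move: h1; rewrite -ay' o0 ltxx.
have [zay|zya] := cw_total aZ z a y za ay zy.
  have := half_disk_r_le _ _ _ _ cz ca cy (ltW ik) zay; rewrite o0 lexx => /(_ isT).
  by rewrite leNgt; move: h2; rewrite orient_swap oppr_lt0 => ->.
have [zay'|zy'a] := cw_total aZ z a y' za ay' zy'; first exact: gap zya zay'.
have := half_disk_r_lt _ _ _ _ cz cy' ca (ltW ik) zy'a h1.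
by rewrite o0 ltxx.
Qed.

(** If [p] were on or beyond [yy'], its sector would have to lie within that of the triangle, so [a]
    does not come after [y] nor [b] before [y']. The half disk of [ab] then contains that of [yy'],
    against the condition along [ab]. *)
Lemma side_tri a b : cw z a b -> triangle S z a b -> tri_open C S z a b p ->
  0 < orient (\val y) (\val y') (klein p).
Proof.
move=> zab [eza eab ezb] [_ oza oab obz]; rewrite ltNge; apply/negP => yy'0.
have [h1 h2] := beyond yy'0.
have [_ _ _ gap] := cyy'; have [zy yy' zy'] := cw_neq _ _ _ zyy'.
have [za ab zb] := cw_neq _ _ _ zab.
have [ca cb] := (circleZ aZ a, circleZ aZ b).
have k1 := ltW ik.
have ya : a = y \/ cw z a y.
  have [->|ay] := pselect (a = y); first by left.
  right; have [//|zya] := cw_total aZ z a y za ay zy; exfalso.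
  have [iza|sza] := edge_in_or_succ C S z a b eza zab; last by case: sza => _ /(_ y).
  have oa := oza iza.
  have [ay'|ay'] := pselect (a = y'); first by move: oa; rewrite ay' ltNge ltW.
  have [zay'|zy'a] := cw_total aZ z a y' za ay' zy'; first exact: gap zya zay'.
  by have := half_disk_r_lt _ _ _ _ cz cy' ca k1 zy'a h1; rewrite ltNge ltW.
have yb : b = y' \/ cw z y' b.
  have [->|by'] := pselect (b = y'); first by left.
  right; have [//|zby'] := cw_total aZ z y' b zy' (nesym by') zb; exfalso.
  have [ibz|sbz] := edge_in_or_succ C S b z a (edgeC _ _ _ _ ezb) (ccwC _ _ _ (ccwC _ _ _ zab)).
    have := obz ibz; rewrite orient_swap oppr_gt0 => ob.
    have [eby|nby] := pselect (b = y).
      by move: ob; rewrite eby; move: h2; rewrite orient_swap oppr_lt0 => h /(lt_trans h); rewrite ltxx.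
    have [zby|zyb] := cw_total aZ z b y zb nby zy; last exact: gap zyb zby'.
    have := half_disk_r_lt _ _ _ _ cz cb cy k1 zby ob.
    by move: h2; rewrite orient_swap oppr_lt0 => h /(lt_trans h); rewrite ltxx.
  by case: sbz => _ /(_ y'); apply; exact: ccwC.
have zay' : cw z a y'.
  by case: ya => [->//|zay]; exact: (cw_trans aZ z a y y').
have ayy' : \val a = \val y \/ cw a y y'.
  by case: ya => [->|zay]; [left|right; exact: (cw_rebase aZ z a y y')].
have ay'b : \val y' = \val b \/ cw a y' b.
  by case: yb => [->|zy'b]; [left|right; exact: (cw_rebase aZ z a y' b)].
have oab0 : orient (\val a) (\val b) (klein p) <= 0.
  exact: (half_disk_le _ (\val y) (\val y')).
have [iab|sab] := edge_in_or_succ C S a b z eab (ccwC _ _ _ zab).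
  by move: (oab iab); rewrite ltNge oab0.
(* The remaining case: [b] is the successor of [a], so there is no condition along [ab]. But nothing
   of [Z] fits strictly between, hence [y = a] and [y' = b], and [yy'] would not be a diagonal. *)
have eay : y = a.
  case: ya => [->//|zay]; case: sab => _ /(_ y) h; exfalso; apply: h.
  case: ay'b => [/val_inj <-|ay'b]; first exact: (cw_rebase aZ z a y y').
  by apply: (cw_trans aZ a y y' b) => //; exact: (cw_rebase aZ z a y y').
have eby : y' = b.
  case: yb => [->//|zy'b]; case: sab => _ /(_ y') h; exfalso; apply: h.
  exact: (cw_rebase aZ z a y' b).
by apply: (in_not_succ y y') => //; rewrite eay eby.
Qed.

End Side.
End Star.

(** * Openness of the map for a locally finite cluster *)

Section LocallyFinite.
Context {R : realType} {k : fieldType} {Z : set (R * R)}.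
Context (C : canonicalCategory k Z) (S : set C).
Context (psi : realization R (clusterK S) -> disk R).
Hypotheses (aZ : admissible Z) (clS : is_cluster S) (psiP : is_psi psi).
Hypothesis lf : locally_finite S.
Implicit Types (x y z a b c : Z) (p : R * R) (q : realization R (clusterK S)).

Notation inS := (in_up_to_iso S).
Notation edgeS := (edge S).
Notation cw x y z := (ccw (\val x) (\val y) (\val z)).
Notation simplex := (closed_simplex R (clusterK S)).
Let f q : R * R := \val (psi q).

(** Ensures that the neighbourhood built below, which stays on the side of [z] of all opposite
    geodesics, really contains the image of [q]. *)
Lemma side_star q z y y' : Defs.support q z -> consecutive C S z y y' -> inS y y' ->
  0 < orient (\val y) (\val y') (klein (f q)).
Proof.
move=> qz cyy' iyy'.
case: (psi_cell C S psi aZ psiP q) => [[x [sx fx]]|[a [b [sab es cq apb]]]|[a [b [iab es iq o0]]]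
  |[a [b [c [tabc abc es tq]]]]].
- by move: qz; rewrite sx => /= ez; subst z; rewrite /f fx; exact: (side_vertex C S aZ _ _ _ cyy').
- move: qz; rewrite es => -[] /= ez; subst z.
    exact: (side_succ C S aZ _ y y' (f q) cyy' b).
  exact: (side_pred C S aZ _ y y' (f q) cyy' a).
- move: qz; rewrite es => -[] /= ez; subst z.
    by apply: (side_geodesic C S aZ _ y y' (f q) cyy' iq b) => //; exact: in_edge.
  apply: (side_geodesic C S aZ _ y y' (f q) cyy' iq a); first exact/in_edge/inC.
  by rewrite orient_swap o0 oppr0.
- have iq : dot (f q) (f q) < 1 by case: tq.
  move: qz; rewrite es => -[[]|] /= ez; subst z.
  + exact: (side_tri C S aZ _ y y' (f q) cyy' iyy' iq b c).
  + apply: (side_tri C S aZ _ y y' (f q) cyy' iyy' iq c a); first exact: ccwC.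
      exact: triangle_rot.
    by rewrite -tri_open_rot.
  + apply: (side_tri C S aZ _ y y' (f q) cyy' iyy' iq a b); first exact/ccwC/ccwC.
      exact/triangle_rot/triangle_rot.
    by rewrite tri_open_rot.
Qed.

Lemma support_nonempty q : exists z, Defs.support q z.
Proof.
case: (support_simplex _ q) => [[x es]|[x [y [_ es]]]|[x [y [z [_ es]]]]]; exists x; rewrite es //.
  by left.
by left; left.
Qed.

(* [psi] is open: near the image of a point of the open star of [z], the plane
   is covered by the images of the finitely many triangles at [z]. *)
Lemma psi_open_nbhs (U : set (realization R (clusterK S))) q : open U -> U q ->
  exists W : set (R * R), [/\ open W, W (f q) &
    forall p, disk R p -> W p -> exists2 q', U q' & f q' = p].
Proof.
move=> oU Uq; have [z qz] := support_nonempty q.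
pose N := [set y | edgeS z y]; have finN : finite_set N by exact: neighbours_finite.
have finNN := finite_setX finN finN.
pose tri (i : Z * Z) := simplex [set z; i.1; i.2].
(* [B1] consists of the points on or beyond the geodesics opposite to [z], and [B2] of the images of
   the parts of the triangles at [z] outside [U]. Finiteness of [N] makes both closed, and the
   neighbourhood sought is the complement of their union. *)
pose B1 := \bigcup_(i in N `*` N) [set p | [/\ consecutive C S z i.1 i.2, inS i.1 i.2 &
  orient (\val i.1) (\val i.2) (klein p) <= 0]].
pose B2 := \bigcup_(i in N `*` N) [set p | consecutive C S z i.1 i.2 /\
  (f @` (tri i `\` U)) p].
have cB1 : closed B1.
  apply: closed_bigcup => // -[y y'] _ /=.
  have [[c i]|n] := pselect (consecutive C S z y y' /\ inS y y'); last first.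
    rewrite (_ : [set _ | _] = set0); first exact: closed0.
    by apply/seteqP; split=> // p [c i _]; apply: n.
  rewrite (_ : [set _ | _] = (fun p => orient (\val y) (\val y') (klein p)) @^-1` [set r | r <= 0]).
    apply: closed_comp; last exact: closed_le.
    by move=> p _; exact: continuous_orient_klein.
  by apply/seteqP; split=> [p []|p ?].
have cB2 : closed B2.
  apply: closed_bigcup => // -[y y'] _ /=.
  have [c|n] := pselect (consecutive C S z y y'); last first.
    rewrite (_ : [set _ | _] = set0); first exact: closed0.
    by apply/seteqP; split=> // p [c _]; apply: n.
  rewrite (_ : [set _ | _] = f @` (tri (y, y') `\` U)); last first.
    by apply/seteqP; split=> [p []|p ?].
  have zyy' : cw z y y' by case: c.
  have t := consecutive_triangle C S aZ clS z y y' c.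
  apply: (homeomorphism_closed_image _ _ _ _ _ (psi_triangle C S psi aZ psiP z y y' t zyy')) => //.
  exact: closed_closed_tri.
exists (~` B1 `&` ~` B2); split.
- by apply: openI; exact: closed_openC.
- split.
    move=> [[y y'] _ /= [c i]]; rewrite leNgt => /negP; apply; exact: (side_star q z y y').
  move=> [[y y'] _ /= [_ [q' [_ nU] e]]]; apply: nU.
  by rewrite (psi_val_inj C S psi aZ clS psiP _ _ e).
- move=> p dp [nB1 nB2].
  have side_ge0 y y' : consecutive C S z y y' -> inS y y' ->
      0 <= orient (\val y) (\val y') (klein p).
    move=> c i; rewrite leNgt; apply/negP => o0; apply: nB1.
    by exists (y, y'); [have [] := c|split=> //; exact: ltW].
  have [y [y' [c tp]]] := star_cover C S aZ z p lf dp side_ge0.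
  have [ezy ezy' zyy' _] := c.
  have t := consecutive_triangle C S aZ clS z y y' c.
  have [g [_ _ im _]] := psi_triangle C S psi aZ psiP z y y' t zyy'.
  move: tp; rewrite -im => -[q' sq' e]; exists q' => //.
  by apply: contrapT => nU; apply: nB2; exists (y, y') => //; split=> //; exists q'.
Qed.

Lemma locally_finite_open : open (range psi).
Proof.
rewrite openE => d [q _ <-].
have [W [oW Wq hW]] := psi_open_nbhs setT q openT I.
apply: (set_type_nbhs _ (psi q) _ W) => // e We.
have [q' _ eq'] := hW (\val e) (set_valP e) We.
by exists q' => //; exact: val_inj.
Qed.

Lemma locally_finite_homeomorphism :
  homeomorphism_onto [set: realization R (clusterK S)] (range psi) psi.
Proof.
have psi_inj := psi_injective C S psi aZ clS psiP.
(* A default value for the inverse off [range psi]. *)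
have [q0] : exists q : realization R (clusterK S), True.
  have [w Zw _] := admissible_other _ aZ 0 0.
  by have [q _] := vertex_point C S psi psiP (exist _ w (mem_set Zw)); exists q.
move=> _; have /choice[g hg] : forall d, exists q, range psi d -> psi q = d.
  by move=> d; have [[q _ <-]|n] := pselect (range psi d); [exists q|exists q0].
have gpsi q : g (psi q) = q by apply: psi_inj; apply: hg; exists q.
exists g; split=> //.
  by apply: continuous_subspaceT; exact: psi_continuous.
apply/subspace_continuousP => _ [q _ <-] V.
rewrite [X in nbhs X _]gpsi nbhsE => -[U [oU Uq] UV].
have [W [oW Wq hW]] := psi_open_nbhs U q oU Uq.
rewrite /nbhs /= /within /=.
apply: (set_type_nbhs _ (psi q) _ W) => // e We [q1 _ e1].
have [q' Uq' eq'] := hW (\val e) (set_valP e) We.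
have <- : psi q' = e by exact: val_inj.
by apply: UV; rewrite [from_subspace _ _ _]gpsi.
Qed.

End LocallyFinite.

Theorem lemma4p17 (R : realType) (k : fieldType) (Z : set (R * R))
    (C : canonicalCategory k Z) (S : set C)
    (psi : realization R (clusterK S) -> disk R) :
  admissible Z -> is_cluster S -> is_psi psi ->
  (continuous psi /\ injective psi) /\
  ((homeomorphism_onto [set: realization R (clusterK S)] (range psi) psi /\
    open (range psi)) <-> locally_finite S).
Proof.
move=> aZ clS psiP; split.
  split; first exact: (psi_continuous C S psi aZ psiP).
  exact: (psi_injective C S psi aZ clS psiP).
split=> [[h _]|lf]; first exact: (homeomorphism_locally_finite C S psi aZ clS psiP).
split; first exact: (locally_finite_homeomorphism C S psi aZ clS psiP).
exact: (locally_finite_open C S psi aZ clS psiP).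
Qed.
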